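(* Let $N$ be a $4$-dimensional neutral space form of constant sectional curvature $L_0$, $M$ a Lorentz surface and $F:M\to N$ a time-like and conformal immersion. Suppose that the normal connection $\nabla^{\perp}$ is flat and that the curvature $K$ of the induced metric satisfies $K\equiv L_0$. Then on a neighborhood of each point of $M$, $F$ has a light-like parallel normal vector field if and only if the second fundamental form of $F$ satisfies the light-like linearly dependent condition, i.e. $$(\alpha_1,\alpha_2,\alpha_3)+\varepsilon(\beta_1,\beta_2,\beta_3)=(0,0,0)\quad\text{for some }\varepsilon\in\{1,-1\}.$$ In addition, if one of these conditions holds, then a light-like parallel normal vector field is given by $a\,e^{-\lambda+\varepsilon\gamma}(N_1-\varepsilon N_2)$ for a nonzero constant $a$ and $\varepsilon\in\{1,-1\}$.
   Context: All objects are smooth. ''Neutral'' means signature $(2,2)$; $h$ is the metric of $N$, $\nabla$ its Levi-Civita connection. Everything is local: $(u,v)$ are local coordinates of $M$ compatible with its paracomplex structure on a simply connected domain, with induced metric $g=e^{2\lambda}(du^2-dv^2)$; $T_1=dF(\partial_u)$, $T_2=dF(\partial_v)$; $N_1,N_2$ are normal vector fields with $h(N_1,N_1)=-h(N_2,N_2)=e^{2\lambda}$, $h(N_1,N_2)=0$. The real functions $\alpha_k,\beta_k,\mu_l$ are defined by: the normal components of $\nabla_{T_1}T_1$, $\nabla_{T_1}T_2$, $\nabla_{T_2}T_2$ are $\alpha_1N_1+\beta_1N_2$, $\alpha_2N_1+\beta_2N_2$, $\alpha_3N_1+\beta_3N_2$; and $\nabla^{\perp}_{T_1}N_1=\lambda_uN_1+\mu_1N_2$,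 $\nabla^{\perp}_{T_1}N_2=\mu_1N_1+\lambda_uN_2$, $\nabla^{\perp}_{T_2}N_1=\lambda_vN_1+\mu_2N_2$, $\nabla^{\perp}_{T_2}N_2=\mu_2N_1+\lambda_vN_2$. Flatness of $\nabla^{\perp}$ means that its curvature tensor $R^{\perp}$ vanishes, equivalently $(\mu_1)_v=(\mu_2)_u$; $\gamma$ is a function with $\gamma_u=\mu_1$, $\gamma_v=\mu_2$. A parallel normal vector field is a nowhere zero normal vector field $\xi$ of $F$ with $\nabla\xi=0$ for the Levi-Civita connection of $N$; it is light-like if $h(\xi,\xi)=0$. *)

(* Defs.v *)
From HB Require Import structures.
From mathcomp Require Import all_boot all_order all_algebra.
From mathcomp Require Import all_classical all_reals all_analysis.

Set Implicit Arguments.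
Unset Strict Implicit.
Unset Printing Implicit Defensive.

Import Order.TTheory GRing.Theory Num.Theory.
Import numFieldNormedType.Exports.

Local Open Scope classical_set_scope.
Local Open Scope ring_scope.

Definition ebase {R : realType} {n : nat} (i : 'I_n) : 'rV[R]_n := delta_mx 0 i.

(* C^infinity on an open set [U]: every iterated directional derivative of [f],
   of any order (including 0), is Frechet differentiable at every point of [U].
   Functions are total; only their germs along the open set [U] matter. *)
Definition smooth_on {R : realType} {V W : normedModType R} (U : set V)
    (f : V -> W) : Prop :=
  forall (s : seq V) (x : V), U x ->
    differentiable (foldr (fun v g => 'D_v g) f s) x.

(* A metric is its Gram matrix [h x] in the coordinate frame at [x]; tangent
   vectors are rows of components in that frame. *)
Section Metric.
Context {R : realType} {n : nat}.
Implicit Types (h : 'rV[R]_n -> 'M[R]_n) (x X Y Z : 'rV[R]_n).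

Definition inner (G : 'M[R]_n) X Y : R := (X *m G *m Y^T) 0 0.

Definition has_signature (p q : nat) (G : 'M[R]_n) : Prop :=
  (p + q)%N = n /\
  exists2 P : 'M[R]_n, P \in unitmx &
    P *m G *m P^T = diag_mx (\row_(i < n) (if (i < p)%N then 1 else - 1)).

Definition pseudo_riemannian (p q : nat) (V : set 'rV[R]_n) h : Prop :=
  smooth_on V h /\
  forall x, V x -> (h x)^T = h x /\ has_signature p q (h x).

(* Koszul's formula for vector fields with constant components (whose brackets
   vanish): [koszul h x X Y 0 l] is h(nabla_X Y, e_l) for the Levi-Civita
   connection. *)
Definition koszul h x X Y : 'rV[R]_n :=
  \row_l (2^-1 * ('D_X (fun y => inner (h y) Y (ebase l)) x
                  + 'D_Y (fun y => inner (h y) X (ebase l)) x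
                  - 'D_(ebase l) (fun y => inner (h y) X Y) x)).

(* Christoffel symbols as a bilinear map: nabla_X Y at [x] for fields [X], [Y]
   with constant components. *)
Definition christoffel h x X Y : 'rV[R]_n := koszul h x X Y *m invmx (h x).

(* R(X,Y)Z = nabla_X nabla_Y Z - nabla_Y nabla_X Z - nabla_[X,Y] Z, computed by
   extending X, Y, Z to vector fields with constant components. *)
Definition riemann h x X Y Z : 'rV[R]_n :=
  'D_X (fun y => christoffel h y Y Z) x + christoffel h x X (christoffel h x Y Z)
  - ('D_Y (fun y => christoffel h y X Z) x
     + christoffel h x Y (christoffel h x X Z)).

Definition gram2 h x X Y : R :=
  inner (h x) X X * inner (h x) Y Y - inner (h x) X Y ^+ 2.

Definition sectional_curvature h x X Y : R :=
  inner (h x) (riemann h x X Y Y) X / gram2 h x X Y.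

(* Sectional curvature is only defined on nondegenerate planes. *)
Definition constant_sectional_curvature (V : set 'rV[R]_n) h (L0 : R) : Prop :=
  forall x X Y, V x -> gram2 h x X Y != 0 -> sectional_curvature h x X Y = L0.

End Metric.

(* [V] is the image of a chart of the space form; it need not be complete or
   simply connected. *)
Definition neutral_space_form {R : realType} (V : set 'rV[R]_4)
    (h : 'rV[R]_4 -> 'M[R]_4) (L0 : R) : Prop :=
  [/\ open V, pseudo_riemannian 2 2 V h & constant_sectional_curvature V h L0].

(* A surface [F] in the chart (V, h), in coordinates (u, v) of R^2, which have
   indices 0 and 1. *)
Section Surface.
Context {R : realType} (h : 'rV[R]_4 -> 'M[R]_4) (F : 'rV[R]_2 -> 'rV[R]_4).
Implicit Types (U W : set 'rV[R]_2) (p : 'rV[R]_2) (i : 'I_2).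
Implicit Types (X xi : 'rV[R]_2 -> 'rV[R]_4).

Definition pd {E : normedModType R} i (f : 'rV[R]_2 -> E) : 'rV[R]_2 -> E :=
  'D_(ebase i) f.

Definition tangent i p : 'rV[R]_4 := pd i F p.

(* h(X, Y) for vector fields along [F]. *)
Definition ip X Y p : R := inner (h (F p)) (X p) (Y p).

Definition induced_metric p : 'M[R]_2 :=
  \matrix_(i, j) ip (tangent i) (tangent j) p.

Definition gauss_curvature p : R :=
  sectional_curvature induced_metric p (ebase 0) (ebase 1).

(* The Levi-Civita connection of [h] on vector fields along [F]. *)
Definition cov i X p : 'rV[R]_4 :=
  pd i X p + christoffel h (F p) (tangent i p) (X p).

(* The orthogonal projection to the normal space, for a nondegenerate induced
   metric. *)
Definition normal_part X p : 'rV[R]_4 :=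
  X p - \sum_i \sum_j
    (invmx (induced_metric p) i j * ip X (tangent i) p) *: tangent j p.

Definition normal_cov i X : 'rV[R]_2 -> 'rV[R]_4 := normal_part (cov i X).

Definition second_fundamental_form i j : 'rV[R]_2 -> 'rV[R]_4 :=
  normal_part (cov i (tangent j)).

Definition normal_field W xi : Prop :=
  smooth_on W xi /\ forall p i, W p -> ip xi (tangent i) p = 0.

(* The curvature R^perp(d_u, d_v) xi; the bracket of coordinate fields is 0. *)
Definition normal_curvature xi p : 'rV[R]_4 :=
  normal_cov 0 (normal_cov 1 xi) p - normal_cov 1 (normal_cov 0 xi) p.

Definition flat_normal_connection U : Prop :=
  forall xi, normal_field U xi -> forall p, U p -> normal_curvature xi p = 0.

(* (u, v) are coordinates compatible with the paracomplex structure, so that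
   conformality means that the induced metric is e^(2 lambda) (du^2 - dv^2); as
   this metric is nondegenerate, [F] is an immersion. *)
Definition timelike_conformal_immersion U (V : set 'rV[R]_4)
    (lambda : 'rV[R]_2 -> R) : Prop :=
  [/\ open U, smooth_on U F, (forall p, U p -> V (F p)), smooth_on U lambda &
      forall p, U p -> induced_metric p =
        expR (2 * lambda p) *: diag_mx (\row_i (if i == 0 then 1 else - 1))].

Definition normal_frame U (lambda : 'rV[R]_2 -> R) N1 N2 : Prop :=
  [/\ normal_field U N1, normal_field U N2 &
      forall p, U p ->
        [/\ ip N1 N1 p = expR (2 * lambda p),
            ip N2 N2 p = - expR (2 * lambda p) & ip N1 N2 p = 0]].

Definition sff_components U N1 N2
    (alpha1 alpha2 alpha3 beta1 beta2 beta3 : 'rV[R]_2 -> R) : Prop :=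
  forall p, U p ->
    [/\ second_fundamental_form 0 0 p = alpha1 p *: N1 p + beta1 p *: N2 p,
        second_fundamental_form 0 1 p = alpha2 p *: N1 p + beta2 p *: N2 p &
        second_fundamental_form 1 1 p = alpha3 p *: N1 p + beta3 p *: N2 p].

Definition normal_connection_components U (lambda : 'rV[R]_2 -> R) N1 N2
    (mu1 mu2 : 'rV[R]_2 -> R) : Prop :=
  forall p, U p ->
    [/\ normal_cov 0 N1 p = pd 0 lambda p *: N1 p + mu1 p *: N2 p,
        normal_cov 0 N2 p = mu1 p *: N1 p + pd 0 lambda p *: N2 p,
        normal_cov 1 N1 p = pd 1 lambda p *: N1 p + mu2 p *: N2 p &
        normal_cov 1 N2 p = mu2 p *: N1 p + pd 1 lambda p *: N2 p].

Definition lightlike_parallel_normal_field W xi : Prop :=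
  normal_field W xi /\
  forall p, W p ->
    [/\ xi p != 0, ip xi xi p = 0 & forall i, cov i xi p = 0].

End Surface.

Definition is_potential {R : realType} (W : set 'rV[R]_2)
    (gamma mu1 mu2 : 'rV[R]_2 -> R) : Prop :=
  smooth_on W gamma /\
  forall p, W p -> pd 0 gamma p = mu1 p /\ pd 1 gamma p = mu2 p.

Definition is_sign {R : realType} (e : R) : Prop := e = 1 \/ e = - 1.

Definition lightlike_dependent {R : realType} (W : set 'rV[R]_2) (e : R)
    (alpha1 alpha2 alpha3 beta1 beta2 beta3 : 'rV[R]_2 -> R) : Prop :=
  forall p, W p ->
    [/\ alpha1 p + e * beta1 p = 0, alpha2 p + e * beta2 p = 0 &
        alpha3 p + e * beta3 p = 0].

Definition explicit_field {R : realType} (lambda gamma : 'rV[R]_2 -> R)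
    (N1 N2 : 'rV[R]_2 -> 'rV[R]_4) (a e : R) (p : 'rV[R]_2) : 'rV[R]_4 :=
  (a * expR (- lambda p + e * gamma p)) *: (N1 p - e *: N2 p).

(* Main.v *)
Require Import Defs.
From HB Require Import structures.
From mathcomp Require Import all_boot all_order all_algebra.
From mathcomp Require Import all_classical all_reals all_analysis.
From mathcomp Require Import ring lra.

(** A normal field [xi] is determined by the two functions [P = h(xi, N1)] and
[Q = h(xi, N2)], because the Gram matrix of the frame (T1, T2, N1, N2) is
diagonal with nonzero entries ([frame_nondeg]); for the same reason
[nabla xi = 0] can be tested by pairing with the frame.  Metric compatibility of
the Levi-Civita connection along [F] ([pd_ip]) turns these pairings into two
conditions.

The pairing with the tangent vectors is
[h(nabla_i xi, T_j) = - h(xi, nabla_i T_j)], the value of the second fundamental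
form against [xi].  For [xi] proportional to [N1 - e N2] this is a nonzero
multiple of [alpha_k + e beta_k], so the tangential part of [nabla xi = 0] is
exactly the light-like dependence.

The pairing with [N1] and [N2] gives the linear system
[P_i = lambda_i P + mu_i Q], [Q_i = mu_i P + lambda_i Q], which is diagonal in the
null components [P + Q] and [P - Q], with rates [lambda_i + mu_i] and
[lambda_i - mu_i].  If [gamma] is a potential of [(mu1, mu2)], then
[P + s Q] is a constant multiple of [exp (lambda + s gamma)] on a connected
domain, for [s = 1] and [s = -1] ([exponential_solution]).  A light-like [xi] has
[P^2 = Q^2], so one of the two constants vanishes; this selects the sign [e] and
gives the explicit field with the other constant as its amplitude
([parallel_field_explicit]).  Conversely the explicit field solves both parts
([explicit_field_parallel]).

It remains to find [gamma].  Evaluating the normal curvature on [N1] and pairing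
with [N2] gives [(mu1)_v = (mu2)_u] ([connection_form_closed]), and the Poincare
lemma on a small square ([poincare_square], [closed_form_potential]) provides a
primitive.  Here the [mu_i] must be known to be smooth: they are, since
[mu_i = - exp (-2 lambda) h(nabla_i N1, N2)], and the class of smooth functions is
closed under sums, products, exponentials and composition
([smooth_class_smooth]). *)

Set Implicit Arguments.
Unset Strict Implicit.

Import Order.TTheory GRing.Theory Num.Theory.
Import numFieldNormedType.Exports.

Local Open Scope classical_set_scope.
Local Open Scope ring_scope.

(** * Smooth functions *)

Section Differentiability.
Context {R : realType} {E G : normedModType R}.
Implicit Types (U : set E) (f g : E -> G).

(** A map approximated to first order by a continuous linear [L] has
differential [L]; the epsilon form avoids choosing a little-o function. *)
Lemma differentiableP_lin f x (L : {linear E -> G}) :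
  continuous L ->
  (forall eps : R, 0 < eps ->
     \forall k \near (0 : E), `|f (k + x) - f x - L k| <= eps * `|k|) ->
  differentiable f x /\ 'd f x = L :> (E -> G).
Proof.
move=> Lc Lf; have fL : f \o shift x = cst (f x) + L +o_ 0 id.
  apply/eqaddoP => eps eps0; near=> k.
  rewrite [X in `|X|](_ : _ = f (k + x) - f x - L k); first by near: k; exact: Lf.
  by rewrite /= opprD addrA.
have dfL := diff_unique Lc fL; split => //.
by apply/diff_locallyP; rewrite dfL.
Unshelve. all: by end_near. Qed.

Lemma differentiable_expansion f x : differentiable f x ->
  forall eps : R, 0 < eps ->
    \forall k \near (0 : E), `|f (k + x) - f x - 'd f x k| <= eps * `|k|.
Proof.
move=> /diff_locallyP[_ /eqaddoP fL] eps /fL; apply: filterS => k.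
by rewrite [X in `|X| <= _](_ : _ = f (k + x) - f x - 'd f x k)//= opprD addrA.
Qed.

Lemma near_eq_differentiable f g x : (\near x, f x = g x) ->
  differentiable f x -> differentiable g x.
Proof.
move=> fg df; suff [] : differentiable g x /\ 'd g x = 'd f x :> (E -> G) by [].
apply: differentiableP_lin => [|eps eps0]; first exact: diff_continuous df.
have fgx : f x = g x by apply: nbhs_singleton fg.
have fg0 : \forall k \near (0 : E), f (k + x) = g (k + x).
  by move: fg; rewrite (near_shift 0 x) /= subr0.
near=> k; rewrite -fgx -(near fg0 k)//.
by near: k; exact: differentiable_expansion.
Unshelve. all: by end_near. Qed.

Lemma open_near U x (P : E -> Prop) :
  open U -> U x -> (forall y, U y -> P y) -> \near x, P x.
Proof. by move=> oU Ux UP; near=> y; apply: UP; near: y; exact: open_nbhs_nbhs.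
Unshelve. all: by end_near. Qed.

Lemma eq_on_derive U f g v x : open U -> U x -> (forall y, U y -> f y = g y) ->
  'D_v f x = 'D_v g x.
Proof. by move=> oU Ux fg; apply: near_eq_derive; exact: open_near fg. Qed.

Lemma eq_on_differentiable U f g x : open U -> U x ->
  (forall y, U y -> f y = g y) -> differentiable f x -> differentiable g x.
Proof. by move=> oU Ux fg; apply: near_eq_differentiable; exact: open_near fg. Qed.

(** The innermost derivative of an iterated one is the last entry of the list
of directions, so smoothness unfolds into differentiability together with
smoothness of all first derivatives. *)
Lemma smooth_onP U f : smooth_on U f <->
  (forall x, U x -> differentiable f x) /\ forall v, smooth_on U ('D_v f).
Proof.
split=> [sf|[df sf] s x Ux].
  split=> [x Ux|v s x Ux]; first exact: (sf [::]).
  by rewrite -foldr_rcons; exact: sf.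
case/lastP: s => [|s v]; first exact: df.
by rewrite foldr_rcons; exact: sf.
Qed.

Lemma smooth_differentiable U f x : smooth_on U f -> U x -> differentiable f x.
Proof. by move=> /smooth_onP[+ _]; exact. Qed.

Lemma smooth_derive U f v : smooth_on U f -> smooth_on U ('D_v f).
Proof. by move=> /smooth_onP[_]; exact. Qed.

Lemma smooth_sub U U' f : U' `<=` U -> smooth_on U f -> smooth_on U' f.
Proof. by move=> UU sf s x /UU; exact: sf. Qed.

(** The principle behind all the smoothness proofs below: if every member of a
class [C] is differentiable, and the derivatives of members coincide on [U] with
members, then induction on the list of directions keeps every iterated derivative
in [C], up to equality on [U]. *)
Lemma smooth_on_class (C : (E -> G) -> Prop) U : open U ->
  (forall f, C f -> forall x, U x -> differentiable f x) ->
  (forall f v, C f -> exists2 g, C g & forall x, U x -> 'D_v f x = g x) ->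
  forall f, C f -> smooth_on U f.
Proof.
move=> oU Cd CD f Cf s; suff [g Cg fg] : exists2 g, C g &
    forall x, U x -> foldr (fun v g => 'D_v g) f s x = g x.
  move=> x Ux; apply: (eq_on_differentiable oU Ux) (Cd _ Cg x Ux).
  by move=> y Uy; rewrite fg.
elim: s => [|v s [g Cg sg]] /=; first by exists f.
have [g' Cg' gg'] := CD g v Cg.
exists g' => // x Ux; rewrite -gg'//; exact: eq_on_derive oU Ux sg.
Qed.

Lemma eq_on_smooth U f g : open U -> (forall x, U x -> f x = g x) ->
  smooth_on U f -> smooth_on U g.
Proof.
move=> oU fg sf.
pose C (k : E -> G) := exists2 f, smooth_on U f & forall x, U x -> f x = k x.
apply: (smooth_on_class (C := C) oU _ _ (f := g)); last by exists f.
- move=> k [k' sk' kk'] x Ux; apply: (eq_on_differentiable oU Ux kk').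
  exact: smooth_differentiable sk' Ux.
- move=> k v [k' sk' kk']; exists ('D_v k).
    exists ('D_v k'); first exact: smooth_derive.
    by move=> x Ux; exact: eq_on_derive oU Ux kk'.
  by [].
Qed.

Lemma smooth_cst U (c : G) : open U -> smooth_on U (cst c).
Proof.
move=> oU; apply: (smooth_on_class (C := fun f => exists c, f = cst c) oU) => //.
- by move=> f [d ->] x _; exact: differentiable_cst.
- move=> f v [d ->]; exists (cst 0); first by exists 0.
  by move=> x _; exact: derive_cst.
- by exists c.
Qed.

End Differentiability.

Lemma derive_comp {R : realType} {E G H : normedModType R} (f : E -> G)
    (g : G -> H) x v : differentiable f x -> differentiable g (f x) ->
  'D_v (g \o f) x = 'D_('D_v f x) g (f x).
Proof.
move=> df dg; rewrite !deriveE//; last exact: differentiable_comp.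
by rewrite diff_comp.
Qed.

Lemma deriveZ_dir {R : realType} {E G : normedModType R} (f : E -> G) x a v :
  differentiable f x -> 'D_(a *: v) f x = a *: 'D_v f x.
Proof. by move=> df; rewrite !deriveE// linearZ. Qed.

Lemma derive_row_sum {R : realType} {n} {G : normedModType R}
    (f : 'rV[R]_n -> G) x (v : 'rV[R]_n) : differentiable f x ->
  'D_v f x = \sum_i v 0 i *: 'D_(ebase i) f x.
Proof.
move=> df; rewrite {1}(row_sum_delta v) deriveE// linear_sum.
by apply: eq_bigr => i _; rewrite linearZ /= deriveE.
Qed.

Lemma differentiable_mx {R : realType} {E : normedModType R} {m n}
    (A : E -> 'M[R]_(m, n)) x :
  differentiable A x <-> forall i j, differentiable (fun x => A x i j) x.
Proof.
split=> [dA i j|dA].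
  exact: (differentiable_comp dA (differentiable_coord _ i j)).
rewrite (_ : A = \sum_i \sum_j (fun x => A x i j *: delta_mx i j)).
  by apply: differentiable_sum => i; apply: differentiable_sum => j;
     exact: differentiableZl.
apply/funext => y; rewrite {1}(matrix_sum_delta (A y)) fct_sumE.
by apply: eq_bigr => i _; rewrite fct_sumE.
Qed.

Lemma derive_coord {R : realType} {E : normedModType R} {m n}
    (A : E -> 'M[R]_(m, n)) x v i j : differentiable A x ->
  'D_v A x i j = 'D_v (fun x => A x i j) x.
Proof. by move=> dA; rewrite derive_mx ?mxE//; exact: diff_derivable. Qed.

Section ScalarDerivatives.
Context {R : realType} {E : normedModType R}.
Implicit Types (f g : E -> R) (x v : E).

Lemma derive_add f g x v : differentiable f x -> differentiable g x ->
  'D_v (fun y => f y + g y) x = 'D_v f x + 'D_v g x.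
Proof. by move=> df dg; apply: deriveD; exact: diff_derivable. Qed.

Lemma derive_mul f g x v : differentiable f x -> differentiable g x ->
  'D_v (fun y => f y * g y) x = f x * 'D_v g x + g x * 'D_v f x.
Proof. by move=> df dg; apply: deriveM; exact: diff_derivable. Qed.

Lemma derive_scal f x v a : differentiable f x ->
  'D_v (fun y => a * f y) x = a * 'D_v f x.
Proof.
move=> df; rewrite (derive_mul v (differentiable_cst a x) df) derive_cst.
by rewrite mulr0 addr0.
Qed.

Lemma differentiable_expR f x : differentiable f x ->
  differentiable (fun y => expR (f y)) x.
Proof.
move=> df; apply: (@differentiable_comp _ _ _ _ f expR) => //.
by apply/derivable1_diffP; exact: derivable_expR.
Qed.

Lemma derive_expR_comp f x v : differentiable f x ->
  'D_v (fun y => expR (f y)) x = 'D_v f x * expR (f x).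
Proof.
move=> df; have de : differentiable expR (f x).
  by apply/derivable1_diffP; exact: derivable_expR.
rewrite (@derive_comp _ _ _ _ f expR)//.
have e1 : 'D_1 expR (f x) = expR (f x) :=
  congr1 (fun k : R -> R => k (f x)) (derive_expR R).
by rewrite -[X in 'D_X _ _]mulr1 deriveZ_dir// e1.
Qed.

End ScalarDerivatives.

(** Iterated derivatives commute with taking an entry as long as they exist,
which the induction on the number of directions provides. *)
Lemma smooth_mx {R : realType} {E : normedModType R} (U : set E) {m n}
    (A : E -> 'M[R]_(m, n)) : open U ->
  smooth_on U A <-> forall i j, smooth_on U (fun x => A x i j).
Proof.
move=> oU; have foldD (B : E -> 'M[R]_(m, n)) i j s :
    (forall t : seq E, (size t < size s)%N -> forall x, U x ->
      differentiable (foldr (fun v g => 'D_v g) B t) x) ->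
    forall x, U x ->
    foldr (fun v g => 'D_v g) (fun x => B x i j) s x =
    foldr (fun v g => 'D_v g) B s x i j.
  elim: s => //= v s IHs dB x Ux.
  rewrite derive_coord; last exact: dB.
  by apply: eq_on_derive oU Ux _ => y Uy; rewrite IHs// => t ts; apply: dB; exact: ltnW.
split=> [sA i j s x Ux|sA s].
  apply: (@eq_on_differentiable _ _ _ U
    (fun x => foldr (fun v g => 'D_v g) A s x i j)) => //.
    by move=> y Uy; rewrite foldD// => t _; exact: sA.
  exact: (differentiable_mx _ _).1 (sA s x Ux) i j.
have [k] := ubnP (size s); elim: k s => // k IHk s sk x Ux.
apply/differentiable_mx => i j.
apply: eq_on_differentiable oU Ux _ (sA i j s x Ux) => y Uy.
by rewrite foldD// => t ts; apply: IHk; exact: leq_trans ts sk.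
Qed.

Section SmoothClosure.
Context {R : realType} {E : normedModType R} (U : set E).
Hypothesis oU : open U.

(** An expression language for smooth functions, with smooth functions as
atoms.  Each constructor is stable under a directional derivative inside the
language (product rule, chain rule), which is what [smooth_on_class] asks for; a
direct induction on the order of derivation would have to expand the Leibniz and
Faa di Bruno formulas. *)
Inductive smooth_class : (E -> R) -> Prop :=
| SC_smooth f : smooth_on U f -> smooth_class f
| SC_add f g : smooth_class f -> smooth_class g ->
    smooth_class (fun x => f x + g x)
| SC_mul f g : smooth_class f -> smooth_class g ->
    smooth_class (fun x => f x * g x)
| SC_exp f : smooth_class f -> smooth_class (fun x => expR (f x))
| SC_comp n (V : set 'rV[R]_n) (F : E -> 'rV[R]_n) g :
    (forall i, smooth_on U (fun x => F x 0 i)) -> (forall x, U x -> V (F x)) ->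
    smooth_on V g -> smooth_class (g \o F).

Lemma smooth_class_differentiable f x : smooth_class f -> U x ->
  differentiable f x.
Proof.
move=> Cf Ux.
elim: Cf => {f} [f sf|f g _ df _ dg|f g _ df _ dg|f _ df|n V F g sF FV sg].
- exact: smooth_differentiable sf Ux.
- exact: differentiableD.
- exact: differentiableM.
- exact: differentiable_expR.
- apply: differentiable_comp.
    apply/differentiable_mx => i j; rewrite ord1.
    exact: smooth_differentiable (sF j) Ux.
  by apply: smooth_differentiable sg _; exact: FV.
Qed.

Lemma smooth_class_sum (I : Type) (r : seq I) (f : I -> E -> R) :
  (forall i, smooth_class (f i)) -> smooth_class (fun x => \sum_(i <- r) f i x).
Proof.
move=> Cf; elim: r => [|i r IHr].
  rewrite (_ : (fun _ => _) = cst 0); last by apply/funext => x; rewrite big_nil.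
  by apply: SC_smooth; exact: smooth_cst.
rewrite (_ : (fun _ => _) = (fun x => f i x + \sum_(j <- r) f j x)).
  exact: SC_add.
by apply/funext => x; rewrite big_cons.
Qed.

Lemma smooth_class_derive f v : smooth_class f ->
  exists2 g, smooth_class g & forall x, U x -> 'D_v f x = g x.
Proof.
elim => {f} [f sf|f g Cf [f' Cf' ff'] Cg [g' Cg' gg']|
  f g Cf [f' Cf' ff'] Cg [g' Cg' gg']|f Cf [f' Cf' ff']|n V F g sF FV sg].
- by exists ('D_v f) => //; apply: SC_smooth; exact: smooth_derive.
- exists (fun x => f' x + g' x); first exact: SC_add.
  move=> x Ux; rewrite -ff'// -gg'//.
  by apply: deriveD; apply: diff_derivable; exact: smooth_class_differentiable.
- exists (fun x => f x * g' x + g x * f' x); first by apply: SC_add; exact: SC_mul.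
  move=> x Ux; rewrite -ff'// -gg'//.
  by apply: deriveM; apply: diff_derivable; exact: smooth_class_differentiable.
- exists (fun x => f' x * expR (f x)); first by apply: SC_mul => //; exact: SC_exp.
  move=> x Ux; rewrite -ff'//.
  by apply: derive_expR_comp; exact: smooth_class_differentiable.
- exists (fun x => \sum_i 'D_v (fun x => F x 0 i) x * 'D_(ebase i) g (F x)).
    apply: smooth_class_sum => i; apply: SC_mul.
      by apply: SC_smooth; exact: smooth_derive.
    by apply: (@SC_comp n V F ('D_(ebase i) g)) => //; exact: smooth_derive.
  move=> x Ux; have dF : differentiable F x.
    apply/differentiable_mx => i j; rewrite ord1.
    exact: smooth_differentiable (sF j) Ux.
  have dg : differentiable g (F x) by apply: smooth_differentiable sg _; exact: FV.
  rewrite derive_comp// derive_row_sum//.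
  by apply: eq_bigr => i _; rewrite derive_coord.
Qed.

Lemma smooth_class_smooth f : smooth_class f -> smooth_on U f.
Proof.
apply: smooth_on_class oU _ _ _ => [k Ck x|]; last exact: smooth_class_derive.
exact: smooth_class_differentiable.
Qed.

Lemma smoothD (f g : E -> R) :
  smooth_on U f -> smooth_on U g -> smooth_on U (fun x => f x + g x).
Proof.
by move=> sf sg; apply: smooth_class_smooth; apply: SC_add; exact: SC_smooth.
Qed.

Lemma smoothM (f g : E -> R) :
  smooth_on U f -> smooth_on U g -> smooth_on U (fun x => f x * g x).
Proof.
by move=> sf sg; apply: smooth_class_smooth; apply: SC_mul; exact: SC_smooth.
Qed.

Lemma smooth_expR (f : E -> R) :
  smooth_on U f -> smooth_on U (fun x => expR (f x)).
Proof. by move=> sf; apply: smooth_class_smooth; apply: SC_exp; exact: SC_smooth. Qed.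

Lemma smooth_sum (I : Type) (r : seq I) (f : I -> E -> R) :
  (forall i, smooth_on U (f i)) -> smooth_on U (fun x => \sum_(i <- r) f i x).
Proof.
move=> sf; apply: smooth_class_smooth; apply: smooth_class_sum => i.
exact: SC_smooth.
Qed.

Lemma smooth_comp {m n k} (V : set 'rV[R]_n) (F : E -> 'rV[R]_n)
    (g : 'rV[R]_n -> 'M[R]_(m, k)) : open V -> smooth_on U F ->
  (forall x, U x -> V (F x)) -> smooth_on V g -> smooth_on U (fun x => g (F x)).
Proof.
move=> oV /(smooth_mx _ oU) sF FV /(smooth_mx _ oV) sg.
apply/(smooth_mx _ oU) => i j.
apply: smooth_class_smooth; apply: (@SC_comp n V F (fun y => g y i j)) => //.
Qed.

Lemma smooth_mulmx {m n k} (A : E -> 'M[R]_(m, n)) (B : E -> 'M[R]_(n, k)) :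
  smooth_on U A -> smooth_on U B -> smooth_on U (fun x => A x *m B x).
Proof.
move=> /(smooth_mx _ oU) sA /(smooth_mx _ oU) sB; apply/(smooth_mx _ oU) => i j.
under eq_fun do rewrite mxE.
by apply: smooth_sum => l; exact: smoothM.
Qed.

End SmoothClosure.

(** * Mean value estimates along lines *)

Section Lines.
Context {R : realType} {E : normedModType R}.
Implicit Types (f : E -> R).

(** Restriction to a line reduces several variables to the one-variable mean
value theorem. *)
Lemma is_derive_line f (x v : E) (s : R) : differentiable f (x + s *: v) ->
  is_derive s 1 (fun t => f (x + t *: v)) ('D_v f (x + s *: v)).
Proof.
pose l := ( *:%R ^~ v : R -> E).
have dl : is_diff s l l by exact: is_diff_scalel.
have dxl : differentiable (cst x + l) s by apply: differentiableD.
move=> df; have dfl : differentiable (f \o (cst x + l)) s.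
  exact: differentiable_comp.
apply: DeriveDef; first exact: diff_derivable.
rewrite (@derive_comp _ _ _ _ (cst x + l) f)// (deriveD (derivable_cst _ _ _)).
  by rewrite derive_cst add0r (deriveE _ (f := l))// diff_val /l scale1r.
exact: diff_derivable.
Qed.

Lemma is_derive_linear (a s : R) : is_derive s 1 (fun t => t * a) a.
Proof.
have ds : is_diff s ( *:%R ^~ a : R -> R) ( *:%R ^~ a) by exact: is_diff_scalel.
apply: DeriveDef; first exact: (diff_derivable (f := *:%R ^~ a : R -> R)).
by rewrite (deriveE (f := *:%R ^~ a : R -> R))// diff_val scale1r.
Qed.

(** The mean value inequality, with the increment [l] of either sign so that no
case distinction is left to its uses. *)
Lemma increment_bound (g dg : R -> R) (l : R) (M : R) :
  (forall s : R, (0 <= s <= l) || (l <= s <= 0) -> is_derive s 1 g (dg s)) ->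
  (forall s : R, (0 <= s <= l) || (l <= s <= 0) -> `|dg s| <= M) ->
  `|g l - g 0| <= M * `|l|.
Proof.
move=> gdg dgM.
have cg (a b : R) : (forall s : R, a <= s <= b -> is_derive s 1 g (dg s)) ->
    {within `[a, b], continuous g}.
  move=> dab; apply: derivable_within_continuous => s; rewrite in_itv/= => sab.
  by have [] := dab s sab.
have [l0|l0] := leP 0 l.
  have d0 s : 0 <= s <= l -> is_derive s 1 g (dg s).
    by move=> sl; apply: gdg; rewrite sl.
  have dm s : s \in `]0, l[ -> is_derive s 1 g (dg s).
    by rewrite in_itv/= => /andP[/ltW s0 /ltW sl]; apply: d0; rewrite s0.
  have [c cl ->] := MVT_segment l0 dm (cg _ _ d0).
  rewrite subr0 normrM ler_wpM2r// dgM//.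
  by move: cl; rewrite in_itv/= => ->.
have d0 s : l <= s <= 0 -> is_derive s 1 g (dg s).
  by move=> sl; apply: gdg; rewrite sl orbT.
have dm s : s \in `]l, 0[ -> is_derive s 1 g (dg s).
  by rewrite in_itv/= => /andP[/ltW s0 /ltW sl]; apply: d0; rewrite s0.
have [c cl] := MVT_segment (ltW l0) dm (cg _ _ d0).
rewrite distrC => ->; rewrite sub0r normrM normrN ler_wpM2r// dgM//.
by move: cl; rewrite in_itv/= => ->; rewrite orbT.
Qed.

(** Young's argument: the mean value theorem along [v] turns the second
difference of [f] on the parallelogram spanned by [t v] and [t w] into an
increment of ['D_v f], which its differentiability at [x] alone evaluates up to
[eps t^2]. *)
Lemma second_difference f (x v w : E) :
  (\near x, differentiable f x) -> differentiable ('D_v f) x ->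
  forall eps : R, 0 < eps -> exists2 r : R, 0 < r & forall t : R, 0 < t < r ->
    `|f (x + t *: v + t *: w) - f (x + t *: v) - f (x + t *: w) + f x
      - t * t * 'D_w ('D_v f) x| <= eps * (t * t).
Proof.
move=> df ddf eps eps0.
(* The points of the parallelogram, and the sum of the two first-order errors,
   are at scale at most t C. *)
set C := 2 * `|v| + `|w| + 1.
have C0 : 0 < C by rewrite /C; have := normr_ge0 v; have := normr_ge0 w; lra.
have /nbhs_ballP[r1 /= r10 Hr1] := df.
have e0 : 0 < eps / C by rewrite divr_gt0.
have /nbhs_ballP[r2 /= r20 Hr2] := differentiable_expansion ddf e0.
exists (Num.min r1 r2 / C); first by rewrite divr_gt0// lt_min r10.
move=> t /andP[t0]; rewrite ltr_pdivlMr// lt_min => /andP[tr1 tr2].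
have near_bound s (b : bool) : 0 <= s <= t ->
    `|s *: v + (if b then t else 0) *: w| <= t * (`|v| + (if b then `|w| else 0)).
  move=> /andP[s0 st]; apply: le_trans (ler_normD _ _) _.
  rewrite !normrZ mulrDr (ger0_norm s0) lerD ?ler_wpM2r//.
  by case: b; rewrite ?normr0 ?mul0r ?mulr0// gtr0_norm.
have near_lt s (b : bool) : 0 <= s <= t ->
    `|s *: v + (if b then t else 0) *: w| < t * C.
  move=> /(near_bound _ b) /le_lt_trans; apply; rewrite ltr_pM2l// /C.
  by case: b; have := normr_ge0 v; have := normr_ge0 w; lra.
have in1 s (b : bool) : 0 <= s <= t ->
    differentiable f (x + (if b then t else 0) *: w + s *: v).
  move=> st; apply: Hr1; rewrite -ball_normE /= -addrA opprD addrA subrr sub0r normrN.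
  rewrite [X in `|X|]addrC; exact: lt_trans (near_lt _ _ st) tr1.
have in2 s (b : bool) : 0 <= s <= t ->
    `|'D_v f (x + (if b then t else 0) *: w + s *: v) - 'D_v f x
      - 'd ('D_v f) x (s *: v + (if b then t else 0) *: w)|
    <= eps / C * (t * (`|v| + (if b then `|w| else 0))).
  move=> st; set k := s *: v + _.
  have -> : x + (if b then t else 0) *: w + s *: v = k + x.
    by rewrite /k [RHS]addrC [s *: v + _]addrC addrA.
  apply: le_trans (Hr2 k _) _.
    rewrite -ball_normE /= sub0r normrN; exact: lt_trans (near_lt _ _ st) tr2.
  by rewrite ler_wpM2l ?(ltW e0)// near_bound.
set L := 'D_w ('D_v f) x.
pose g s := f (x + t *: w + s *: v) - f (x + s *: v) - s * (t * L).
pose dg s := 'D_v f (x + t *: w + s *: v) - 'D_v f (x + s *: v) - t * L.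
have := @increment_bound g dg t (eps * t).
have -> : g t - g 0 = f (x + t *: v + t *: w) - f (x + t *: v) - f (x + t *: w) + f x
      - t * t * L.
  by rewrite /g scale0r !addr0 (addrAC x (t *: w)); ring.
rewrite (gtr0_norm t0) mulrA; apply.
  move=> s sb; have st : 0 <= s <= t by move: sb => /orP[//|]; lra.
  have d1 := is_derive_line (in1 s true st).
  have := in1 s false st; rewrite scale0r addr0 => /is_derive_line d0.
  have dt := is_derive_linear (t * L) s.
  exact: is_deriveB.
move=> s sb; have st : 0 <= s <= t by move: sb => /orP[//|]; lra.
have i1 := in2 s true st.
have := in2 s false st; rewrite /= scale0r !addr0 => i0.
have dgE : dg s = ('D_v f (x + t *: w + s *: v) - 'D_v f x
     - 'd ('D_v f) x (s *: v + t *: w))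
   - ('D_v f (x + s *: v) - 'D_v f x - 'd ('D_v f) x (s *: v)).
  rewrite /dg /L (deriveE w ddf) linearD.
  have -> : 'd ('D_v f) x (t *: w) = t * 'd ('D_v f) x w by rewrite linearZ.
  by ring.
rewrite dgE; apply: le_trans (ler_normB _ _) _.
apply: le_trans (lerD i1 i0) _.
rewrite -!mulrDr.
have -> : eps / C * (t * (`|v| + `|w| + `|v|)) =
    eps * t * ((`|v| + `|w| + `|v|) / C) by field; rewrite gt_eqF.
apply: ler_piMr; first by rewrite mulr_ge0 ?(ltW eps0) ?(ltW t0).
by rewrite ler_pdivrMr// mul1r /C; lra.
Qed.

(** The second difference is symmetric in [v] and [w], and divided by [t^2] it
tends to each of the two mixed derivatives. *)
Lemma schwarz_derive f (x v w : E) : (\near x, differentiable f x) ->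
  differentiable ('D_v f) x -> differentiable ('D_w f) x ->
  'D_w ('D_v f) x = 'D_v ('D_w f) x.
Proof.
move=> df dv dw; apply/eqP; rewrite -subr_eq0 -normr_le0.
apply/ler_addgt0Pl => eps eps0; rewrite addr0.
have e20 : 0 < eps / 2 by rewrite divr_gt0.
have [r1 r10 Hr1] := second_difference w df dv e20.
have [r2 r20 Hr2] := second_difference v df dw e20.
pose t := Num.min r1 r2 / 2.
have t0 : 0 < t by rewrite divr_gt0// lt_min r10.
have tlt : t < Num.min r1 r2 by rewrite /t ltr_pdivrMr// ltr_pMr ?lt_min ?r10// ltr1n.
move: tlt; rewrite lt_min => /andP[tr1 tr2].
have := Hr1 t; rewrite t0 tr1 => /(_ isT) A.
have := Hr2 t; rewrite t0 tr2 => /(_ isT).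
rewrite (addrAC x (t *: w)) => B.
rewrite -(ler_pM2r (mulr_gt0 t0 t0)) -{1}(gtr0_norm (mulr_gt0 t0 t0)) -normrM.
set D := f _ in A B; set P := 'D_w ('D_v f) x; set Q := 'D_v ('D_w f) x.
move: A B; rewrite -/P -/Q; set a := f (x + t *: v); set b := f (x + t *: w).
move=> A B; have -> : (P - Q) * (t * t) =
   (D - b - a + f x - t * t * Q) - (D - a - b + f x - t * t * P) by ring.
apply: le_trans (ler_normB _ _) _; apply: le_trans (lerD B A) _.
by rewrite -mulrDl -splitr.
Qed.

Lemma ball_segment (x y : E) (r s : R) : ball x r y -> 0 <= s <= 1 ->
  ball x r (x + s *: (y - x)).
Proof.
rewrite -!ball_normE /= => xyr /andP[s0 s1].
rewrite opprD addrA subrr sub0r normrN normrZ ger0_norm// distrC in xyr *.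
by apply: le_lt_trans xyr; rewrite ler_piMl.
Qed.

(** A level set of [f] is open in [W] because [f] is constant along the radii
of small balls, and closed in [W] for the same reason. *)
Lemma connected_gradient0 (W : set E) f : open W -> connected W ->
  (forall x, W x -> differentiable f x) ->
  (forall x v, W x -> 'D_v f x = 0) ->
  forall x y, W x -> W y -> f x = f y.
Proof.
move=> oW cW df Df0.
have loc x : W x -> exists2 r : R, 0 < r & ball x r `<=` W /\
    forall y, ball x r y -> f y = f x.
  move=> Wx; have /nbhs_ballP[r /= r0 rW] : nbhs x W by exact: open_nbhs_nbhs.
  exists r => //; split=> // y xy.
  have := @increment_bound (fun s => f (x + s *: (y - x))) (fun=> 0) 1 0.
  rewrite scale0r addr0 scale1r (addrC x) subrK mul0r => H.
  apply/eqP; rewrite -subr_eq0 -normr_le0; apply: H => s; last by rewrite normr0.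
  move=> sb; have s01 : 0 <= s <= 1 by move: sb => /orP[//|]; lra.
  have Ws : W (x + s *: (y - x)) by apply: rW; exact: ball_segment.
  by rewrite -(Df0 _ (y - x) Ws); apply: is_derive_line; exact: df.
move=> x y Wx Wy; pose B := [set z | W z /\ f z = f x].
suff BW : B = W by move: Wy; rewrite -BW => -[].
apply: cW; first by exists x.
- exists B; last by apply/seteqP; split=> z; [move=> []|move=> [_ []]].
  rewrite openE => z [Wz fz]; have [r r0 [rW rf]] := loc z Wz.
  by apply/nbhs_ballP; exists r => // u zu; split; [exact: rW|rewrite rf].
- exists (closure B); first exact: closed_closure.
  apply/seteqP; split=> z; first by move=> Bz; split; [case: Bz|exact: subset_closure].
  move=> [Wz Bz]; have [r r0 [rW rf]] := loc z Wz.
  have [u [[Wu fu] zu]] := Bz _ (nbhsx_ballx z r r0).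
  by split=> //; rewrite -fu (rf u).
Qed.

End Lines.

(** * Primitives of closed forms in the plane *)

Section Poincare.
Context {R : realType}.

Lemma is_derive_translate (g : R -> R) (y s d : R) :
  is_derive (y + s) 1 g d -> is_derive s 1 (fun s => g (y + s)) d.
Proof.
move=> gd; rewrite -[d]mulr1.
apply: (is_derive1_comp (f := g) (g := fun s => y + s)).
rewrite -[X in is_derive _ _ _ X]add0r.
exact: (is_deriveD (f := cst y) (g := id)).
Qed.

(** The fundamental theorem of calculus on a closed interval starting at
[- r'], normalised to vanish at 0; the margin between [r'] and [r] makes the
integrand continuous up to the ends of the interval. *)
Lemma antiderivative (f : R -> R) (r r' : R) : 0 < r' < r ->
  (forall s : R, `|s| < r -> {for s, continuous f}) ->
  exists2 G : R -> R, G 0 = 0 &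
    forall s : R, `|s| < r' -> is_derive s 1 G (f s).
Proof.
move=> /andP[r'0 r'r] cf.
have intf : lebesgue_measure.-integrable `[- r', r'] (EFin \o f).
  apply: continuous_compact_integrable; first exact: segment_compact.
  apply: continuous_in_subspaceT => s; rewrite inE /= in_itv/= => sr.
  by apply: cf; apply: le_lt_trans r'r; rewrite ler_norml.
pose I x := Rintegral lebesgue_measure [set` `[- r', x]] f.
exists (fun x => I x - I 0) => [|s sr]; first by rewrite subrr.
have /andP[s1 s2] : - r' < s < r' by rewrite -ltr_norml.
have [] := continuous_FTC1_closed s2 intf s1 (cf _ (lt_trans sr r'r)).
move=> dI I'; have {}dI : is_derive s 1 I (f s).
  by apply: (DeriveDef dI); rewrite -derive1E.
rewrite -[f s]subr0.
exact: (@is_deriveB _ _ _ I (cst (I 0)) _ _ _ _ dI (is_derive_cst _ _ _)).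
Qed.

Lemma ord2_ind (P : 'I_2 -> Prop) : P 0 -> P 1 -> forall i, P i.
Proof.
by move=> P0 P1 [[|[|//]] hi]; [rewrite (_ : Ordinal hi = 0)|
  rewrite (_ : Ordinal hi = 1)]; rewrite //; exact: val_inj.
Qed.

(** Coordinates centred at [p]; the balls of the sup norm around [p] are
squares in them. *)
Definition square_point (p : 'rV[R]_2) (x y : R) : 'rV[R]_2 :=
  p + x *: ebase 0 + y *: ebase 1.

Lemma square_pointE0 p x y : square_point p x y 0 0 = p 0 0 + x.
Proof. by rewrite !mxE /= mulr1 mulr0 addr0. Qed.

Lemma square_pointE1 p x y : square_point p x y 0 1 = p 0 1 + y.
Proof. by rewrite !mxE /= mulr1 mulr0 addr0. Qed.

Lemma square_point_coord p q : square_point p ((q - p) 0 0) ((q - p) 0 1) = q.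
Proof.
apply/rowP; apply: ord2_ind.
  by rewrite square_pointE0 !mxE addrCA subrr addr0.
by rewrite square_pointE1 !mxE addrCA subrr addr0.
Qed.

Lemma square_point_translate p x y (k : 'rV[R]_2) :
  k + square_point p x y = square_point p (x + k 0 0) (y + k 0 1).
Proof.
apply/rowP; apply: ord2_ind; rewrite mxE.
  by rewrite !square_pointE0 addrC addrA.
by rewrite !square_pointE1 addrC addrA.
Qed.

Lemma coord_le_norm n (k : 'rV[R]_n) i : `|k 0 i| <= `|k|.
Proof. by rewrite [leRHS]/Num.norm /= mx_normrE (le_bigmax _ _ (0, i)). Qed.

Lemma ball_square_point p r (x y : R) :
  ball p r (square_point p x y) <-> `|x| < r /\ `|y| < r.
Proof.
split=> [[r0 H]|[xr yr]].
  have := H 0 0; have := H 0 1; rewrite square_pointE0 square_pointE1.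
  by rewrite -!ball_normE /= !opprD !addrA !subrr !sub0r !normrN.
split; first exact: le_lt_trans xr.
move=> i; rewrite [i]ord1 {i}; apply: ord2_ind.
  by rewrite square_pointE0 -ball_normE /= opprD addrA subrr sub0r normrN.
by rewrite square_pointE1 -ball_normE /= opprD addrA subrr sub0r normrN.
Qed.

Lemma norm_between (u l s d : R) : (0 <= s <= l) || (l <= s <= 0) ->
  `|u| < d -> `|u + l| < d -> `|u + s| < d.
Proof.
by rewrite !ltr_norml => /orP[] /andP[? ?] /andP[? ?] /andP[? ?];
  apply/andP; split; lra.
Qed.

(** Apply the mean value inequality to [f t - t (df 0)], whose derivative is
itself an increment of [df]. *)
Lemma taylor1_bound (f df ddf : R -> R) (k M : R) : 0 <= M ->
  (forall t : R, (0 <= t <= k) || (k <= t <= 0) -> is_derive t 1 f (df t)) ->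
  (forall t : R, (0 <= t <= k) || (k <= t <= 0) -> is_derive t 1 df (ddf t)) ->
  (forall t : R, (0 <= t <= k) || (k <= t <= 0) -> `|ddf t| <= M) ->
  `|f k - f 0 - k * df 0| <= M * `|k| * `|k|.
Proof.
move=> M0 dfP ddfP ddfM.
have -> : f k - f 0 - k * df 0 = (f k - k * df 0) - (f 0 - 0 * df 0) by ring.
apply: (@increment_bound R (fun t => f t - t * df 0) (fun t => df t - df 0)) => t tk.
  exact: (@is_deriveB _ _ _ _ _ _ _ _ _ (dfP t tk) (is_derive_linear _ t)).
have tt s : (0 <= s <= t) || (t <= s <= 0) -> (0 <= s <= k) || (k <= s <= 0).
  move: tk => /orP[] /andP[? ?] /orP[] /andP[? ?]; apply/orP;
    by [left; apply/andP; split; lra|right; apply/andP; split; lra].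
apply: (@le_trans _ _ (M * `|t|)).
  by apply: (@increment_bound R df ddf) => s /tt; [exact: ddfP|exact: ddfM].
rewrite ler_wpM2l//; move: tk => /orP[] /andP[t1 t2].
  by rewrite !ger0_norm// (le_trans t1).
by rewrite !ler0_norm ?lerN2// (le_trans t1).
Qed.

(** The potential is the integral of the form along the path that runs
horizontally from [p] and then vertically.  Its vertical derivative is [b] by
construction.  For the horizontal one, the difference of two vertical integrals
is compared with [k] times the increment of [a] along the vertical segment: by
closedness, the derivative of the error in the vertical direction is the
first-order Taylor remainder of [b] in the horizontal direction, of size
[M k^2].  The bound [M] on a second derivative thus replaces differentiation under
the integral sign. *)
Lemma poincare_square (p : 'rV[R]_2) (r r' M : R) (a b : 'rV[R]_2 -> R) :
  0 < r' < r ->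
  (forall q, ball p r q ->
    [/\ differentiable a q, differentiable b q,
        differentiable ('D_(ebase 0) b) q,
        `|'D_(ebase 0) ('D_(ebase 0) b) q| <= M &
        'D_(ebase 1) a q = 'D_(ebase 0) b q]) ->
  exists gamma : 'rV[R]_2 -> R, forall q, ball p r' q ->
    differentiable gamma q /\
    forall v : 'rV[R]_2, 'D_v gamma q = v 0 0 * a q + v 0 1 * b q.
Proof.
move=> r'r ab; have [r'0 ltr'r] := andP r'r.
have dom x y : `|x| < r -> `|y| < r -> ball p r (square_point p x y).
  by move=> xr yr; apply/ball_square_point.
have line0 (f : 'rV[R]_2 -> R) x y : differentiable f (square_point p x y) ->
    is_derive x 1 (fun x => f (square_point p x y))
      ('D_(ebase 0) f (square_point p x y)).
  have E x' : square_point p x' y = square_point p 0 y + x' *: ebase 0.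
    by rewrite /square_point scale0r addr0 addrAC.
  rewrite E => df; have := is_derive_line df.
  by under eq_fun do rewrite -E.
have line1 (f : 'rV[R]_2 -> R) x y : differentiable f (square_point p x y) ->
    is_derive y 1 (fun y => f (square_point p x y))
      ('D_(ebase 1) f (square_point p x y)).
  have E y' : square_point p x y' = square_point p x 0 + y' *: ebase 1.
    by rewrite /square_point scale0r addr0.
  rewrite E => df; have := is_derive_line df.
  by under eq_fun do rewrite -E.
have is_derive_cont (f : R -> R) (s d : R) : is_derive s 1 f d -> {for s, continuous f}.
  by move=> [+ _] => /derivable1_diffP; exact: differentiable_continuous.
have r0 : `|0 : R| < r by rewrite normr0 (lt_trans r'0).
have [A A0 dA] : exists2 A : R -> R, A 0 = 0 &
    forall s : R, `|s| < r' -> is_derive s 1 A (a (square_point p s 0)).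
  apply: antiderivative r'r _ => s sr.
  by have [/line0/is_derive_cont] := ab _ (dom s 0 sr r0).
have exB (x : R) : exists B : R -> R, `|x| < r -> B 0 = 0 /\
    forall s : R, `|s| < r' -> is_derive s 1 B (b (square_point p x s)).
  have [xr|] := boolP (`|x| < r); last by exists (fun=> 0).
  suff [B B0 dB] : exists2 B : R -> R, B 0 = 0 &
    forall s : R, `|s| < r' -> is_derive s 1 B (b (square_point p x s)) by exists B.
  apply: antiderivative r'r _ => s sr.
  by have [_ /line1/is_derive_cont] := ab _ (dom x s xr sr).
have [B BP] := choice exB.
have M0 : 0 <= M.
  by have [_ _ _ + _] := ab _ (dom 0 0 r0 r0); exact: le_trans.
have transversal (x y k0 : R) : `|x| < r' -> `|y| < r' -> `|x + k0| < r' ->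
    `|B (x + k0) y - B x y
      - k0 * (a (square_point p x y) - a (square_point p x 0))|
    <= M * `|k0| * `|k0| * `|y|.
  move=> xr yr xkr.
  have xrr := lt_trans xr ltr'r; have xkrr := lt_trans xkr ltr'r.
  pose g (s : R) := B (x + k0) s - B x s - k0 * a (square_point p x s).
  pose dg (s : R) := b (square_point p (x + k0) s) - b (square_point p x s)
    - k0 * 'D_(ebase 1) a (square_point p x s).
  have gy : g y - g 0 =
      B (x + k0) y - B x y - k0 * (a (square_point p x y) - a (square_point p x 0)).
    rewrite /g; have [-> _] := BP _ xkrr; have [-> _] := BP _ xrr.
    by ring.
  rewrite -gy.
  have sr' s : (0 <= s <= y) || (y <= s <= 0) -> `|s| < r'.
    by move=> sy; rewrite -[s]add0r; apply: (norm_between sy); rewrite ?normr0 ?add0r.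
    apply: (@increment_bound R g dg y (M * `|k0| * `|k0|)) => s /sr' s_r'.
      have s_r := lt_trans s_r' ltr'r.
      have [_ /(_ s s_r') d1] := BP _ xkrr; have [_ /(_ s s_r') d2] := BP _ xrr.
      have [/line1 d3 _ _ _ _] := ab _ (dom x s xrr s_r).
      have d4 := @is_deriveZ _ _ _ _ k0 _ _ _ d3.
      exact: (@is_deriveB _ _ _ _ _ _ _ _ _ (@is_deriveB _ _ _ _ _ _ _ _ _ d1 d2) d4).
    have s_r := lt_trans s_r' ltr'r.
    have xt t : (0 <= t <= k0) || (k0 <= t <= 0) -> `|x + t| < r.
      by move=> tk; exact: norm_between tk xrr xkrr.
    have d1 t : (0 <= t <= k0) || (k0 <= t <= 0) ->
        is_derive t 1 (fun t => b (square_point p (x + t) s))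
          ('D_(ebase 0) b (square_point p (x + t) s)).
      move=> /xt xtr; have [_ d0 _ _ _] := ab _ (dom _ s xtr s_r).
      exact: is_derive_translate (line0 _ _ _ d0).
    have d2 t : (0 <= t <= k0) || (k0 <= t <= 0) ->
        is_derive t 1 (fun t => 'D_(ebase 0) b (square_point p (x + t) s))
          ('D_(ebase 0) ('D_(ebase 0) b) (square_point p (x + t) s)).
      move=> /xt xtr; have [_ _ d00 _ _] := ab _ (dom _ s xtr s_r).
      exact: is_derive_translate (line0 _ _ _ d00).
    have bM t : (0 <= t <= k0) || (k0 <= t <= 0) ->
        `|'D_(ebase 0) ('D_(ebase 0) b) (square_point p (x + t) s)| <= M.
      by move=> /xt xtr; have [] := ab _ (dom _ s xtr s_r).
    have := taylor1_bound M0 d1 d2 bM.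
    by have [_ _ _ _ abE] := ab _ (dom x s xrr s_r); rewrite /= addr0 -abE.
(* A integrates a along the horizontal axis through p, and B x integrates b
   along the vertical line of abscissa x. *)
pose gamma (q : 'rV[R]_2) := A ((q - p) 0 0) + B ((q - p) 0 0) ((q - p) 0 1).
have gammaE x y : gamma (square_point p x y) = A x + B x y.
  rewrite /gamma; congr (A _ + B _ _);
  by rewrite mxE ?square_pointE0 ?square_pointE1 mxE addrAC subrr add0r.
exists gamma => q; rewrite -(square_point_coord p q).
set x : R := (q - p) 0 0; set y : R := (q - p) 0 1.
move=> /ball_square_point[xr yr].
have xrr := lt_trans xr ltr'r; have yrr := lt_trans yr ltr'r.
set q' := square_point p x y.
have [da db _ _ _] := ab _ (dom x y xrr yrr).
pose L (k : 'rV[R]_2) := k 0 0 * a q' + k 0 1 * b q'.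
have Llin : linear L.
  by move=> c u v; rewrite /L !mxE /GRing.scale /=; ring.
pose Lm := GRing.isLinear.Build _ _ _ _ _ Llin.
pose L' : {linear 'rV[R]_2 -> R} := HB.pack L Lm.
have Lc : continuous L'.
  move=> k; apply: (@differentiable_continuous _ _ _ _ L).
  by apply: differentiableD; apply: differentiableM => //; exact: differentiable_coord.
suff est : forall eps : R, 0 < eps -> \forall k \near (0 : 'rV[R]_2),
    `|gamma (k + q') - gamma q' - L' k| <= eps * `|k|.
  have [dg dgL] := differentiableP_lin Lc est; split=> // v.
  by rewrite deriveE// dgL.
move=> eps eps0.
have e3 : 0 < eps / 3 by rewrite divr_gt0.
have horizontal : \forall k \near (0 : 'rV[R]_2), `|x + (k : 'rV[R]_2) 0 0| < r' ->
    `|A (x + k 0 0) - A x - k 0 0 * a (square_point p x 0)| <= eps / 3 * `|k|.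
  have dA1 := dA x xr.
  have /derivable1_diffP dfA : derivable A x 1 by have [] := dA1.
  have /nbhs_ballP[d /= d0 Hd] := differentiable_expansion dfA e3.
  apply/nbhs_ballP; exists d => //= k; rewrite -ball_normE /= sub0r normrN => kd _.
  have := Hd (k 0 0); rewrite -ball_normE /= sub0r normrN (addrC (k 0 0) x).
  have dAk : 'd A x (k 0 0) = k 0 0 * a (square_point p x 0).
    rewrite diff1E//; have := derive_val (is_derive := dA1).
    by rewrite -derive1E => ->.
  move=> /(_ (le_lt_trans (coord_le_norm _ _) kd)); rewrite dAk => /le_trans; apply.
  by rewrite ler_wpM2l ?(ltW e3)//; exact: coord_le_norm.
have transport : \forall k \near (0 : 'rV[R]_2), `|x + (k : 'rV[R]_2) 0 0| < r' ->
    `|B (x + k 0 0) y - B x y - k 0 0 * (a q' - a (square_point p x 0))|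
      <= eps / 3 * `|k|.
  have c0 : 0 < eps / 3 / (M * r' + 1).
    by rewrite divr_gt0// ltr_wpDl// mulr_ge0// ltW.
  apply/nbhs_ballP; exists (eps / 3 / (M * r' + 1)) => //= k.
  rewrite -ball_normE /= sub0r normrN => kd xkr.
  have k0d := le_lt_trans (coord_le_norm k 0) kd.
  set k0 : R := k 0 0 in xkr k0d *.
  apply: le_trans (transversal _ _ _ xr yr xkr) _.
  rewrite (_ : M * `|k0| * `|k0| * `|y| = `|k0| * (M * `|y|) * `|k0|); last by ring.
  apply: le_trans (_ : eps / 3 * `|k0| <= _); last first.
    by rewrite ler_wpM2l ?(ltW e3)//; exact: coord_le_norm.
  rewrite ler_wpM2r//; have Mr' : 0 < M * r' + 1 by rewrite ltr_wpDl// mulr_ge0// ltW.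
  have := ltW k0d; rewrite ler_pdivlMr//; apply: le_trans.
  rewrite ler_wpM2l//; have : M * `|y| <= M * r' by rewrite ler_wpM2l// ltW.
  by move=> /le_trans; apply; rewrite lerDl.
have vertical : \forall k \near (0 : 'rV[R]_2), `|x + (k : 'rV[R]_2) 0 0| < r' ->
    `|y + k 0 1| < r' ->
    `|B (x + k 0 0) (y + k 0 1) - B (x + k 0 0) y - k 0 1 * b q'| <= eps / 3 * `|k|.
  have /cvgrPdist_le /(_ _ e3) := differentiable_continuous db.
  move=> /nbhs_ballP[d /= d0 Hd].
  apply/nbhs_ballP; exists d => //= k.
  rewrite -ball_normE /= sub0r normrN => kd xkr ykr.
  have xkrr := lt_trans xkr ltr'r.
  pose g (s : R) := B (x + k 0 0) (y + s) - s * b q'.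
  pose dg (s : R) := b (square_point p (x + k 0 0) (y + s)) - b q'.
  have -> : B (x + k 0 0) (y + k 0 1) - B (x + k 0 0) y - k 0 1 * b q' =
      g (k 0 1) - g 0.
    by rewrite /g addr0; ring.
  apply: (@le_trans _ _ (eps / 3 * `|k 0 1|)); last first.
    by rewrite ler_wpM2l ?(ltW e3)//; exact: coord_le_norm.
  apply: (@increment_bound R g dg (k 0 1) (eps / 3)) => s sk.
    have ysr : `|y + s| < r' by exact: norm_between sk yr ykr.
    have [_ /(_ _ ysr)/is_derive_translate d1] := BP _ xkrr.
    exact: (@is_deriveB _ _ _ _ _ _ _ _ _ d1 (is_derive_linear _ s)).
  rewrite /dg distrC; apply: Hd; rewrite -ball_normE /=.
  pose k' : 'rV[R]_2 := \row_i (if i == 0 then k 0 0 else s).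
  have -> : square_point p (x + k 0 0) (y + s) = k' + q'.
    by rewrite square_point_translate !mxE.
  rewrite opprD addrCA subrr addr0 normrN; apply: le_lt_trans kd.
  rewrite [leLHS]/Num.norm /= mx_normrE; apply: bigmax_le => // -[i j] _ /=.
  rewrite mxE; case: ifP => _; first exact: coord_le_norm.
  apply: le_trans (coord_le_norm k 1).
  move: sk => /orP[] /andP[t1 t2].
    by rewrite !ger0_norm// (le_trans t1).
  by rewrite !ler0_norm ?lerN2// (le_trans t1).
have small : \forall k \near (0 : 'rV[R]_2),
    `|x + (k : 'rV[R]_2) 0 0| < r' /\ `|y + k 0 1| < r'.
  have xd : 0 < r' - `|x| by rewrite subr_gt0.
  have yd : 0 < r' - `|y| by rewrite subr_gt0.
  apply/nbhs_ballP; exists (Num.min (r' - `|x|) (r' - `|y|)).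
    by rewrite /= lt_min xd.
  move=> k; rewrite -ball_normE /= sub0r normrN lt_min !ltrBrDl => /andP[kx ky].
  split; apply: le_lt_trans (ler_normD _ _) _.
    by apply: le_lt_trans kx; rewrite lerD2l coord_le_norm.
  by apply: le_lt_trans ky; rewrite lerD2l coord_le_norm.
apply: filter_app (filterI horizontal (filterI transport (filterI vertical small))).
apply: filterE => k [t1 [t2 [t3 [xk yk]]]].
rewrite square_point_translate !gammaE.
have -> : A (x + k 0 0) + B (x + k 0 0) (y + k 0 1) - (A x + B x y) - L' k =
   (A (x + k 0 0) - A x - k 0 0 * a (square_point p x 0)) +
   (B (x + k 0 0) y - B x y - k 0 0 * (a q' - a (square_point p x 0))) +
   (B (x + k 0 0) (y + k 0 1) - B (x + k 0 0) y - k 0 1 * b q').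
  by rewrite /L' /= /L; ring.
have -> : eps * `|k| = eps / 3 * `|k| + eps / 3 * `|k| + eps / 3 * `|k|.
  by field.
apply: le_trans (ler_normD _ _) _; rewrite lerD//.
  apply: le_trans (ler_normD _ _) _; rewrite lerD//.
    exact: t1.
  exact: t2.
exact: t3.
Qed.

End Poincare.

(** The first derivatives of the primitive are combinations of the given smooth
functions with constant coefficients, so the primitive is itself smooth. *)
Lemma closed_form_potential {R : realType} (U : set 'rV[R]_2)
    (a b : 'rV[R]_2 -> R) p : open U -> smooth_on U a -> smooth_on U b ->
  (forall q, U q -> pd 1 a q = pd 0 b q) -> U p ->
  exists W0 : set 'rV[R]_2, [/\ open W0, W0 p, W0 `<=` U &
    exists gamma, is_potential W0 gamma a b].
Proof.
move=> oU sa sb ab Up.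
have sb0 := smooth_derive (ebase 0) sb.
have sb00 := smooth_derive (ebase 0) sb0.
set c := 'D_(ebase 0) ('D_(ebase 0) b) in sb00.
have cc : {for p, continuous c}.
  exact: differentiable_continuous (smooth_differentiable sb00 Up).
(* Continuity bounds the second derivative on a neighborhood of p, which
   serves as the square. *)
have cM : \forall q \near p, `|c q| <= `|c p| + 1.
  have /cvgrPdist_le /(_ _ ltr01) := cc; apply: filterS => q cq.
  have := lerB_dist (c q) (c p); rewrite distrC => h1; have := le_trans h1 cq.
  by rewrite lerBlDl.
have : \forall q \near p, U q /\ `|c q| <= `|c p| + 1.
  by apply: filterI cM; exact: open_nbhs_nbhs.
move=> /nbhs_ballP[r /= r0 rU].
have r20 : 0 < r / 2 < r by apply/andP; split; lra.
have [|gamma gammaP] := @poincare_square R p r (r / 2) (`|c p| + 1) a b r20.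
  move=> q /rU[Uq cq]; split => //; [exact: smooth_differentiable sa Uq|
    exact: smooth_differentiable sb Uq|exact: smooth_differentiable sb0 Uq|].
  exact: ab.
have r2r : ball p (r / 2) `<=` U.
  by move=> q pq; apply: (rU q _).1; apply: le_ball pq; lra.
have r2_gt0 : 0 < r / 2 by lra.
exists (ball p (r / 2)); split => //.
- exact: ball_open.
- exact: ballxx.
exists gamma; split.
  apply/smooth_onP; split=> [q /gammaP[]//|v].
  apply: (eq_on_smooth (f := fun q => v 0 0 * a q + v 0 1 * b q)).
  - exact: ball_open.
  - by move=> q /gammaP[_ ->].
  have ob : open (ball p (r / 2)) by exact: ball_open.
  apply: (smoothD ob); apply: (smoothM ob).
  - exact: (smooth_cst (v 0 0) ob).
  - exact: smooth_sub sa.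
  - exact: (smooth_cst (v 0 1) ob).
  - exact: smooth_sub sb.
move=> q /gammaP[_ gD]; rewrite /pd !gD /ebase !mxE /=.
by rewrite !mul1r !mul0r addr0 add0r.
Qed.

(** * Derivatives of matrix products *)

Section MatrixDerivatives.
Context {R : realType} {E : normedModType R}.

Lemma differentiable_mulmx m n k (A : E -> 'M[R]_(m, n)) (B : E -> 'M[R]_(n, k)) x :
  differentiable A x -> differentiable B x ->
  differentiable (fun y => A y *m B y) x.
Proof.
move=> /differentiable_mx dA /differentiable_mx dB; apply/differentiable_mx => i j.
rewrite (_ : (fun _ => _) = \sum_l (fun y => A y i l * B y l j)).
  by apply: differentiable_sum => l; exact: differentiableM.
by apply/funext => y; rewrite mxE fct_sumE.
Qed.

Lemma derive_mulmx m n k (A : E -> 'M[R]_(m, n)) (B : E -> 'M[R]_(n, k)) x v :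
  differentiable A x -> differentiable B x ->
  'D_v (fun y => A y *m B y) x = 'D_v A x *m B x + A x *m 'D_v B x.
Proof.
move=> dA dB; apply/matrixP => i j.
rewrite derive_coord; last exact: differentiable_mulmx.
have dAc := (differentiable_mx _ _).1 dA; have dBc := (differentiable_mx _ _).1 dB.
rewrite (_ : (fun _ => _) = \sum_l (fun y => A y i l * B y l j)); last first.
  by apply/funext => y; rewrite mxE fct_sumE.
rewrite derive_sum => [|l]; last first.
  by apply: diff_derivable; exact: differentiableM.
rewrite !mxE -big_split /=; apply: eq_bigr => l _.
rewrite (@deriveM _ _ (fun y => A y i l) (fun y => B y l j)); try exact: diff_derivable.
by rewrite !derive_coord// /GRing.scale /=; ring.
Qed.

Lemma differentiable_trmx m n (A : E -> 'M[R]_(m, n)) x :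
  differentiable A x -> differentiable (fun y => (A y)^T) x.
Proof.
move=> /differentiable_mx dA; apply/differentiable_mx => i j.
by rewrite (_ : (fun _ => _) = (fun y => A y j i))//; apply/funext => y; rewrite mxE.
Qed.

Lemma derive_trmx m n (A : E -> 'M[R]_(m, n)) x v : differentiable A x ->
  'D_v (fun y => (A y)^T) x = ('D_v A x)^T.
Proof.
move=> dA; apply/matrixP => i j; rewrite derive_coord; last exact: differentiable_trmx.
rewrite mxE derive_coord//; congr ('D_v _ x).
by apply/funext => y; rewrite mxE.
Qed.

Lemma derive_inner n (G : E -> 'M[R]_n) (X Y : E -> 'rV[R]_n) x v :
  differentiable G x -> differentiable X x -> differentiable Y x ->
  'D_v (fun y => inner (G y) (X y) (Y y)) x =
  inner ('D_v G x) (X x) (Y x) + inner (G x) ('D_v X x) (Y x)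
    + inner (G x) (X x) ('D_v Y x).
Proof.
move=> dG dX dY; have dXG := differentiable_mulmx dX dG.
have dYT := differentiable_trmx dY.
have := @derive_coord _ _ _ _ (fun y => X y *m G y *m (Y y)^T) x v 0 0
  (differentiable_mulmx dXG dYT).
rewrite derive_mulmx// derive_mulmx// derive_trmx// => <-.
rewrite /inner !mxE -!big_split /=; apply: eq_bigr => l _.
rewrite !mxE; ring.
Qed.

End MatrixDerivatives.

(** * Symmetric forms and the Levi-Civita connection *)

Lemma ebaseE {R : realType} n (i j : 'I_n) : ebase i 0 j = (j == i)%:R :> R.
Proof. by rewrite mxE eqxx. Qed.

Section Inner.
Context {R : realType} {n : nat}.
Implicit Types (G : 'M[R]_n) (X Y Z : 'rV[R]_n).

Lemma innerDl G X X' Y : inner G (X + X') Y = inner G X Y + inner G X' Y.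
Proof. by rewrite /inner !mulmxDl mxE. Qed.

Lemma innerZl G a X Y : inner G (a *: X) Y = a * inner G X Y.
Proof. by rewrite /inner -!scalemxAl mxE. Qed.

Lemma innerBl G X X' Y : inner G (X - X') Y = inner G X Y - inner G X' Y.
Proof. by rewrite innerDl -scaleN1r innerZl mulN1r. Qed.

Lemma inner0l G Y : inner G 0 Y = 0.
Proof. by rewrite -(scale0r 0) innerZl mul0r. Qed.

Lemma innerDr G X Y Y' : inner G X (Y + Y') = inner G X Y + inner G X Y'.
Proof. by rewrite /inner linearD mulmxDr mxE. Qed.

Lemma inner0r G X : inner G X 0 = 0.
Proof. by rewrite /inner trmx0 mulmx0 mxE. Qed.

Lemma inner_suml (I : Type) (r : seq I) G (X : I -> 'rV[R]_n) Y :
  inner G (\sum_(i <- r) X i) Y = \sum_(i <- r) inner G (X i) Y.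
Proof.
by elim/big_rec2: _ => [|i a b _ <-]; [exact: inner0l|exact: innerDl].
Qed.

Lemma inner_sym G X Y : G^T = G -> inner G X Y = inner G Y X.
Proof.
move=> GT; rewrite /inner -[X *m G *m Y^T]trmxK [LHS]mxE.
by rewrite !trmx_mul trmxK GT mulmxA.
Qed.

Lemma inner_sumr_ebase G X Z :
  inner G X Z = \sum_l Z 0 l * inner G X (ebase l).
Proof.
rewrite /inner mxE; apply: eq_bigr => l _; rewrite [Z^T _ _]mxE mulrC; congr (_ * _).
rewrite [RHS]mxE (bigD1 l)//= big1 ?addr0; last first.
  by move=> j jl; rewrite [(ebase l)^T j 0]mxE ebaseE (negbTE jl) mulr0.
by rewrite [(ebase l)^T l 0]mxE ebaseE eqxx mulr1.
Qed.

Lemma inner_nondeg G X : G \in unitmx -> (forall Z, inner G X Z = 0) -> X = 0.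
Proof.
move=> Gu XZ; have : X *m G = 0.
  apply/rowP => j; rewrite [RHS]mxE -(XZ (ebase j)).
  rewrite /inner [RHS]mxE (bigD1 j)//= big1 => [|k kj].
    by rewrite [(ebase j)^T j 0]mxE ebaseE eqxx mulr1 addr0.
  by rewrite [(ebase j)^T k 0]mxE ebaseE (negbTE kj) mulr0.
by move=> /(canRL (mulmxK Gu)); rewrite mul0mx.
Qed.

(** Raising an index with the inverse of the Gram matrix and pairing again
gives back the linear form. *)
Lemma inner_invmx G (K : 'rV[R]_n) Z : G \in unitmx ->
  inner G (K *m invmx G) Z = \sum_l K 0 l * Z 0 l.
Proof.
move=> Gu; rewrite /inner mulmxKV// mxE.
by apply: eq_bigr => l _; rewrite [Z^T _ _]mxE.
Qed.

Lemma inner_sum_form (I : Type) (r : seq I) (c : I -> R) (G : I -> 'M[R]_n) X Y :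
  inner (\sum_(i <- r) c i *: G i) X Y = \sum_(i <- r) c i * inner (G i) X Y.
Proof.
rewrite /inner mulmx_sumr mulmx_suml summxE; apply: eq_bigr => i _.
by rewrite -scalemxAr -scalemxAl mxE.
Qed.

(** The matrix with rows [f i] has the nondegenerate diagonal Gram matrix of
the family, so it is invertible and its rows span. *)
Lemma orthogonal_family_nondeg G (f : 'I_n -> 'rV[R]_n) X :
  (forall i j, i != j -> inner G (f i) (f j) = 0) ->
  (forall i, inner G (f i) (f i) != 0) ->
  (forall i, inner G X (f i) = 0) -> X = 0.
Proof.
move=> orth f0 Xf; pose A := \matrix_i f i.
have rowA i : row i A = f i by rewrite rowK.
have entry m (B : 'M[R]_(m, n)) i j : (B *m G *m A^T) i j = inner G (row i B) (f j).
  rewrite /inner -row_mul !mxE; apply: eq_bigr => k _.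
  by rewrite [A^T k j]mxE [(f j)^T k 0]mxE [A j k]mxE [in RHS]mxE.
have AGA : A *m G *m A^T = diag_mx (\row_i inner G (f i) (f i)).
  apply/matrixP => i j; rewrite entry rowA !mxE.
  by have [->|ij] := eqVneq i j; rewrite ?mulr1n// mulr0n orth.
have Au : A^T \in unitmx.
  have : A *m G *m A^T \in unitmx.
    rewrite AGA unitmxE det_diag unitfE; apply/prodf_neq0 => i _.
    by rewrite mxE f0.
  by rewrite unitmx_mul => /andP[].
have Gu : G \in unitmx.
  have : A *m G *m A^T \in unitmx.
    rewrite AGA unitmxE det_diag unitfE; apply/prodf_neq0 => i _.
    by rewrite mxE f0.
  by rewrite !unitmx_mul => /andP[/andP[]].
have : X *m G *m A^T = 0.
  apply/matrixP => i j; rewrite entry [RHS]mxE -(Xf j); congr (inner _ _ _).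
  by apply/rowP => k; rewrite mxE [i]ord1.
by move=> /(canRL (mulmxK Au)); rewrite mul0mx => /(canRL (mulmxK Gu)); rewrite mul0mx.
Qed.

End Inner.

(** Locked, as an abstract form depending on a direction: the Levi-Civita
connection enters below only through Koszul's formula and the symmetry of this
form. *)
HB.lock Definition metric_derivative {R : realType} {n : nat}
    (h : 'rV[R]_n -> 'M[R]_n) x (Z : 'rV[R]_n) : 'M[R]_n := 'D_Z h x.

Section AmbientConnection.
Context {R : realType} {n : nat} (V : set 'rV[R]_n) (h : 'rV[R]_n -> 'M[R]_n).
Hypotheses (oV : open V) (sh : smooth_on V h)
  (hT : forall x, V x -> (h x)^T = h x) (hu : forall x, V x -> h x \in unitmx).

(** Koszul's formula for an arbitrary third vector: the definition pairs with
the basis vectors only, and both sides are linear in [Z]. *)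
Lemma christoffel_pairing x X Y Z : V x ->
  inner (h x) (christoffel h x X Y) Z =
  2^-1 * (inner (metric_derivative h x X) Y Z + inner (metric_derivative h x Y) X Z
    - inner (metric_derivative h x Z) X Y).
Proof.
move=> Vx; have dh := smooth_differentiable sh Vx.
have dc (W W' W'' : 'rV[R]_n) :
    'D_W (fun y => inner (h y) W' W'') x = inner (metric_derivative h x W) W' W''.
  rewrite metric_derivative.unlock (@derive_inner _ _ _ h (cst W') (cst W''))//.
  by rewrite !derive_cst /= inner0l inner0r !addr0.
rewrite /christoffel inner_invmx ?hu//.
have -> : metric_derivative h x Z =
    \sum_l Z 0 l *: metric_derivative h x (ebase l).
  by rewrite metric_derivative.unlock; exact: derive_row_sum.
rewrite inner_sum_form.
rewrite (inner_sumr_ebase _ Y Z) (inner_sumr_ebase _ X Z).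
rewrite -big_split -sumrB /= mulr_sumr; apply: eq_bigr => l _.
have -> : koszul h x X Y 0 l = 2^-1 * (inner (metric_derivative h x X) Y (ebase l)
    + inner (metric_derivative h x Y) X (ebase l)
    - inner (metric_derivative h x (ebase l)) X Y).
  by rewrite mxE (dc X) (dc Y) (dc (ebase l)).
by rewrite -mulrDr -mulrBr -mulrA [_ * Z 0 l]mulrC.
Qed.

Lemma derive_metric_sym x Z : V x ->
  (metric_derivative h x Z)^T = metric_derivative h x Z.
Proof.
move=> Vx; have dh := smooth_differentiable sh Vx.
rewrite metric_derivative.unlock -derive_trmx//; exact: eq_on_derive oV Vx hT.
Qed.

Lemma christoffelC x X Y : V x -> christoffel h x X Y = christoffel h x Y X.
Proof.
move=> Vx; apply/eqP; rewrite -subr_eq0; apply/eqP.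
apply: (inner_nondeg (hu Vx)) => Z; rewrite innerBl !christoffel_pairing//.
rewrite (inner_sym X Y); last exact: derive_metric_sym.
by rewrite [_ + inner _ Y Z]addrC subrr.
Qed.

(** In the sum of the two Koszul formulas the terms other than the derivative
along [T] cancel in pairs. *)
Lemma metric_compatibility x T X Y : V x ->
  inner (metric_derivative h x T) X Y =
  inner (h x) (christoffel h x T X) Y + inner (h x) X (christoffel h x T Y).
Proof.
move=> Vx; have hs := hT Vx; have dhs := derive_metric_sym T Vx.
rewrite (inner_sym X (christoffel h x T Y) hs).
rewrite (christoffel_pairing T X Y Vx) (christoffel_pairing T Y X Vx).
rewrite (inner_sym Y X dhs).
move: (inner (metric_derivative h x T) X Y) (inner (metric_derivative h x X) T Y)
  (inner (metric_derivative h x Y) T X) => a b c.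
by field.
Qed.

End AmbientConnection.

(** * Vector fields along the surface *)

Section AlongSurface.
Context {R : realType} (V : set 'rV[R]_4) (h : 'rV[R]_4 -> 'M[R]_4)
  (U : set 'rV[R]_2) (F : 'rV[R]_2 -> 'rV[R]_4).
Hypotheses (oV : open V) (sh : smooth_on V h)
  (hT : forall x, V x -> (h x)^T = h x) (hu : forall x, V x -> h x \in unitmx)
  (oU : open U) (sF : smooth_on U F) (FV : forall p, U p -> V (F p)).
Implicit Types (p : 'rV[R]_2) (X Y Z : 'rV[R]_2 -> 'rV[R]_4) (i j : 'I_2).

Lemma ip_sym X Y p : U p -> ip h F X Y p = ip h F Y X p.
Proof. by move=> Up; apply: inner_sym; apply: hT; exact: FV. Qed.

Lemma smooth_tangent i : smooth_on U (tangent F i).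
Proof. exact: smooth_derive. Qed.

(** The chain rule for [h] composed with [F] contributes the derivative of the
metric along the tangent vector, which metric compatibility splits into the two
Christoffel terms. *)
Lemma pd_ip i X Y p : U p -> differentiable X p -> differentiable Y p ->
  pd i (ip h F X Y) p = ip h F (cov h F i X) Y p + ip h F X (cov h F i Y) p.
Proof.
move=> Up dX dY; have Vp := FV Up.
have dF := smooth_differentiable sF Up; have dh := smooth_differentiable sh Vp.
have dhF : differentiable (h \o F) p by exact: differentiable_comp.
have hs := hT Vp.
have dhFE : 'D_(ebase i) (h \o F) p = metric_derivative h (F p) (tangent F i p).
  by rewrite metric_derivative.unlock; exact: derive_comp.
have -> : pd i (ip h F X Y) p = inner ('D_(ebase i) (h \o F) p) (X p) (Y p)
    + inner (h (F p)) (pd i X p) (Y p) + inner (h (F p)) (X p) (pd i Y p).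
  exact: (derive_inner (ebase i) dhF dX dY).
have covX : ip h F (cov h F i X) Y p = inner (h (F p)) (pd i X p) (Y p)
    + inner (h (F p)) (christoffel h (F p) (tangent F i p) (X p)) (Y p).
  exact: innerDl.
have covY : ip h F X (cov h F i Y) p = inner (h (F p)) (X p) (pd i Y p)
    + inner (h (F p)) (X p) (christoffel h (F p) (tangent F i p) (Y p)).
  exact: innerDr.
rewrite covX covY dhFE.
rewrite (metric_compatibility oV sh hT hu (tangent F i p) (X p) (Y p) Vp).
by rewrite [RHS]addrACA [RHS]addrC addrA.
Qed.

(** Torsion-freeness along the surface: equality of mixed partial derivatives of
[F] and symmetry of the Christoffel symbols. *)
Lemma cov_tangentC i j p : U p ->
  cov h F i (tangent F j) p = cov h F j (tangent F i) p.
Proof.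
move=> Up; have cC := christoffelC oV sh hT hu (tangent F i p) (tangent F j p) (FV Up).
suff ijC : pd i (tangent F j) p = pd j (tangent F i) p.
  exact: (congr2 +%R ijC cC).
apply/rowP => k.
have sFk := (smooth_mx F oU).1 sF 0 k.
have sD l : smooth_on U ('D_(ebase l) (fun q => F q 0 k)) by exact: smooth_derive.
have coord l q : U q -> tangent F l q 0 k = 'D_(ebase l) (fun q => F q 0 k) q.
  by move=> Uq; exact: derive_coord (smooth_differentiable sF Uq).
have coord2 l m : pd l (tangent F m) p 0 k =
    'D_(ebase l) ('D_(ebase m) (fun q => F q 0 k)) p.
  apply: etrans (eq_on_derive (ebase l) oU Up (coord m)).
  exact: derive_coord (smooth_differentiable (smooth_tangent m) Up).
apply: etrans (coord2 i j) (etrans _ (esym (coord2 j i))); apply: schwarz_derive.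
- by apply: open_near oU Up _ => q; exact: smooth_differentiable sFk.
- exact: smooth_differentiable (sD j) Up.
- exact: smooth_differentiable (sD i) Up.
Qed.

Lemma smooth_entry (G : 'rV[R]_2 -> 'M[R]_4) X Y :
  smooth_on U G -> smooth_on U X -> smooth_on U Y ->
  smooth_on U (fun p => inner (G p) (X p) (Y p)).
Proof.
move=> sG sX sY; have sYT : smooth_on U (fun p => (Y p)^T).
  apply/(smooth_mx _ oU) => i j.
  apply: (eq_on_smooth (f := fun p => Y p j i)) => //; first by move=> p _; rewrite mxE.
  exact: ((smooth_mx Y oU).1 sY j i).
have /(smooth_mx _ oU) := smooth_mulmx oU (smooth_mulmx oU sX sG) sYT.
exact.
Qed.

Lemma smooth_ip X Y : smooth_on U X -> smooth_on U Y -> smooth_on U (ip h F X Y).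
Proof. by apply: smooth_entry; exact: smooth_comp sh. Qed.

Lemma smooth_derive_metric X : smooth_on U X ->
  smooth_on U (fun p => metric_derivative h (F p) (X p)).
Proof.
move=> /(smooth_mx _ oU) sX; apply/(smooth_mx _ oU) => i j.
apply: (eq_on_smooth (f := fun p =>
    \sum_k X p 0 k * ('D_(ebase k) h (F p)) i j)) => //.
  move=> p /FV Vp; rewrite metric_derivative.unlock.
  rewrite (derive_row_sum _ (smooth_differentiable sh Vp)) summxE.
  by apply: eq_bigr => k _; rewrite mxE.
apply: (smooth_sum oU) => k; apply: (smoothM oU) => //.
have /(smooth_mx _ oU) := smooth_comp oU oV sF FV (smooth_derive (ebase k) sh).
exact.
Qed.

(** The Koszul formula expresses the Christoffel term without the inverse of
the metric, so that sums, products and composition with [F] suffice. *)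
Lemma smooth_ip_cov i X Y : smooth_on U X -> smooth_on U Y ->
  smooth_on U (ip h F (cov h F i X) Y).
Proof.
move=> sX sY; have sT := smooth_tangent i.
apply: (eq_on_smooth (f := fun p => inner (h (F p)) (pd i X p) (Y p) +
  2^-1 * (inner (metric_derivative h (F p) (tangent F i p)) (X p) (Y p)
    + inner (metric_derivative h (F p) (X p)) (tangent F i p) (Y p)
    + - 1 * inner (metric_derivative h (F p) (Y p)) (tangent F i p) (X p)))) => //.
  move=> p /FV Vp; rewrite /ip /cov innerDl.
  rewrite (christoffel_pairing sh hu (tangent F i p) (X p) (Y p) Vp).
  by rewrite mulN1r.
apply: (smoothD oU); first by apply: smooth_ip => //; exact: smooth_derive.
apply: (smoothM oU); first exact: (smooth_cst _ oU).
apply: (smoothD oU).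
  by apply: (smoothD oU); apply: smooth_entry => //; exact: smooth_derive_metric.
apply: (smoothM oU); first exact: (smooth_cst _ oU).
by apply: smooth_entry => //; exact: smooth_derive_metric.
Qed.

(** The projection removes a tangential vector, which a normal [Y] does not
see. *)
Lemma ip_normal_part X Y p : (forall j, ip h F Y (tangent F j) p = 0) -> U p ->
  ip h F (normal_part h F X) Y p = ip h F X Y p.
Proof.
move=> Yn Up; rewrite /ip /normal_part innerBl inner_suml big1 ?subr0// => j _.
rewrite inner_suml big1// => k _; rewrite innerZl.
by rewrite inner_sym ?[inner _ _ _]Yn ?mulr0//; apply: hT; exact: FV.
Qed.

End AlongSurface.

(** * Parallel fields in a normal frame *)

(** The quotient of [f] by [expR w] has zero gradient. *)
Lemma exponential_solution {R : realType} n (W : set 'rV[R]_n)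
    (f w : 'rV[R]_n -> R) : open W -> connected W ->
  (forall q, W q -> differentiable f q) -> (forall q, W q -> differentiable w q) ->
  (forall i q, W q -> 'D_(ebase i) f q = 'D_(ebase i) w q * f q) ->
  forall p, W p -> exists c, forall q, W q -> f q = c * expR (w q).
Proof.
move=> oW cW df dw fw p Wp; pose g q := expR (- 1 * w q) * f q.
have dmw q : W q -> differentiable (fun q => - 1 * w q) q.
  by move=> Wq; apply: differentiableM => //; exact: dw.
have de q : W q -> differentiable (fun q => expR (- 1 * w q)) q.
  by move=> Wq; apply: differentiable_expR; exact: dmw.
have dg q : W q -> differentiable g q.
  by move=> Wq; apply: differentiableM; [exact: de|exact: df].
have g0 q v : W q -> 'D_v g q = 0.
  move=> Wq; rewrite (derive_row_sum v (dg q Wq)) big1// => i _.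
  suff -> : 'D_(ebase i) g q = 0 by rewrite scaler0.
  rewrite (derive_mul _ (de q Wq) (df q Wq)) (derive_expR_comp _ (dmw q Wq)).
  rewrite (derive_scal _ _ (dw q Wq)) fw//; ring.
exists (g p) => q Wq; rewrite (connected_gradient0 oW cW dg g0 Wp Wq) /g mulN1r.
by rewrite mulrAC -expRD addNr expR0 mul1r.
Qed.

Section NormalFrame.
Context {R : realType} (V : set 'rV[R]_4) (h : 'rV[R]_4 -> 'M[R]_4)
  (U : set 'rV[R]_2) (F : 'rV[R]_2 -> 'rV[R]_4) (lambda : 'rV[R]_2 -> R)
  (N1 N2 : 'rV[R]_2 -> 'rV[R]_4) (mu : 'I_2 -> 'rV[R]_2 -> R).
Hypotheses (oV : open V) (sh : smooth_on V h)
  (hT : forall x, V x -> (h x)^T = h x) (hu : forall x, V x -> h x \in unitmx)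
  (oU : open U) (sF : smooth_on U F) (FV : forall p, U p -> V (F p))
  (slambda : smooth_on U lambda)
  (TT : forall p i j, U p ->
    (ip h F (tangent F i) (tangent F j) p == 0) = (i != j))
  (sN1 : smooth_on U N1) (sN2 : smooth_on U N2)
  (N1T : forall p i, U p -> ip h F N1 (tangent F i) p = 0)
  (N2T : forall p i, U p -> ip h F N2 (tangent F i) p = 0)
  (N11 : forall p, U p -> ip h F N1 N1 p = expR (2 * lambda p))
  (N22 : forall p, U p -> ip h F N2 N2 p = - expR (2 * lambda p))
  (N12 : forall p, U p -> ip h F N1 N2 p = 0)
  (D1 : forall i p, U p -> normal_cov h F i N1 p =
    pd i lambda p *: N1 p + mu i p *: N2 p)
  (D2 : forall i p, U p -> normal_cov h F i N2 p =
    mu i p *: N1 p + pd i lambda p *: N2 p).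

Local Notation "<< X , Y >>" := (ip h F X Y).

Lemma N21 p : U p -> <<N2, N1>> p = 0.
Proof. by move=> Up; rewrite (ip_sym hT FV)// N12. Qed.

(** The frame is orthogonal without null vectors, hence a basis whose pairings
separate vectors. *)
Lemma frame_nondeg p (X : 'rV[R]_2 -> 'rV[R]_4) : U p ->
  (forall i, <<X, tangent F i>> p = 0) -> <<X, N1>> p = 0 -> <<X, N2>> p = 0 ->
  X p = 0.
Proof.
move=> Up XT XN1 XN2; pose N (j : 'I_2) := if j == 0 then N1 else N2.
(* The four frame vectors as one family, tangent vectors first. *)
pose f (k : 'I_4) : 'rV[R]_4 :=
  match @fintype.split 2 2 k with inl i => tangent F i p | inr j => N j p end.
have NT j i : <<N j, tangent F i>> p = 0.
  by rewrite /N; case: ifP => _; [exact: N1T|exact: N2T].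
have NN j j' : (<<N j, N j'>> p == 0) = (j != j').
  have e0 := expR_gt0 (2 * lambda p).
  have neg1 : (1 : 'I_2) != 0 by [].
  move: j j'; apply: ord2_ind; apply: ord2_ind; rewrite /N ?eqxx ?(negbTE neg1).
  - by rewrite N11// gt_eqF.
  - by rewrite N12// eqxx.
  - by rewrite N21// eqxx.
  - by rewrite N22// oppr_eq0 gt_eqF.
apply: (@orthogonal_family_nondeg _ _ (h (F p)) f).
- move=> k l kl; rewrite /f.
  have : @fintype.split 2 2 k != @fintype.split 2 2 l.
    by apply: contra kl => /eqP/(can_inj (@splitK 2 2)) ->.
  case: (@fintype.split 2 2 k) (@fintype.split 2 2 l) => [i|i] [j|j] ij; apply/eqP.
  + by rewrite -[inner _ _ _]/(<<tangent F i, tangent F j>> p) TT.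
  + rewrite -[inner _ _ _]/(<<tangent F i, N j>> p) (ip_sym hT FV)//.
    by rewrite NT.
  + by rewrite -[inner _ _ _]/(<<N i, tangent F j>> p) NT.
  + by rewrite -[inner _ _ _]/(<<N i, N j>> p) NN.
- move=> k; rewrite /f; case: (@fintype.split 2 2 k) => i.
  + by rewrite -[inner _ _ _]/(<<tangent F i, tangent F i>> p) TT// eqxx.
  + by rewrite -[inner _ _ _]/(<<N i, N i>> p) NN eqxx.
- move=> k; rewrite /f; case: (@fintype.split 2 2 k) => i; first exact: XT.
  by rewrite /N; case: ifP.
Qed.

Lemma ip_covN1 i p Y : U p -> (forall j, <<Y, tangent F j>> p = 0) ->
  <<cov h F i N1, Y>> p = pd i lambda p * <<N1, Y>> p + mu i p * <<N2, Y>> p.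
Proof.
move=> Up YT; rewrite -(ip_normal_part hT FV (cov h F i N1) YT Up).
apply: etrans (congr1 (fun Z => inner (h (F p)) Z (Y p)) (D1 i Up)) _.
by rewrite innerDl !innerZl.
Qed.

Lemma ip_covN2 i p Y : U p -> (forall j, <<Y, tangent F j>> p = 0) ->
  <<cov h F i N2, Y>> p = mu i p * <<N1, Y>> p + pd i lambda p * <<N2, Y>> p.
Proof.
move=> Up YT; rewrite -(ip_normal_part hT FV (cov h F i N2) YT Up).
apply: etrans (congr1 (fun Z => inner (h (F p)) Z (Y p)) (D2 i Up)) _.
by rewrite innerDl !innerZl.
Qed.

(** Pairing [nabla_i N1] with [N2] isolates [mu i], because [N1] and [N2] are
orthogonal. *)
Lemma smooth_connection_form i : smooth_on U (mu i).
Proof.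
have scovN : smooth_on U <<cov h F i N1, N2>>.
  exact: (smooth_ip_cov oV sh hu oU sF FV i sN1 sN2).
apply: (eq_on_smooth (f := fun p =>
  - 1 * (expR (- 2 * lambda p) * <<cov h F i N1, N2>> p)) oU).
  move=> p Up; rewrite ip_covN1//; last by move=> j; exact: N2T.
  have e1 : expR (- 2 * lambda p) * expR (2 * lambda p) = 1.
    by rewrite -expRD mulNr addNr expR0.
  by rewrite N12// N22// mulr0 add0r mulrN mulrN mulN1r opprK mulrCA e1 mulr1.
apply: (smoothM oU); first exact: (smooth_cst _ oU).
apply: (smoothM oU); last exact: scovN.
apply: (smooth_expR oU).
by apply: (smoothM oU) => //; exact: (smooth_cst _ oU).
Qed.

Lemma derive_conformal_factor i p : U p ->
  pd i (fun q => expR (2 * lambda q)) p = 2 * pd i lambda p * expR (2 * lambda p).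
Proof.
move=> Up; have dl := smooth_differentiable slambda Up.
have d2l : differentiable (fun q => 2 * lambda q) p.
  by apply: differentiableM => //; exact: differentiable_cst.
by rewrite /pd (derive_expR_comp _ d2l) (derive_scal _ _ dl).
Qed.

(** Only the term [- pd i (mu j)] of this expression is not symmetric in [i]
and [j]; pairing with [N2] also makes the second derivatives of [lambda]
disappear. *)
Lemma ip_cov_normal_cov i j p : U p ->
  <<cov h F i (normal_cov h F j N1), N2>> p =
  expR (2 * lambda p) *
    (- pd i (mu j) p - pd i lambda p * mu j p - pd j lambda p * mu i p).
Proof.
move=> Up; set X := normal_cov h F j N1.
have sdl : smooth_on U (pd j lambda) by exact: smooth_derive.
have dX : differentiable X p.
  apply: (eq_on_differentiable oU Up
    (f := (fun q => pd j lambda q *: N1 q) + (fun q => mu j q *: N2 q))).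
    by move=> q Uq; rewrite /X D1.
  have smu := smooth_connection_form j.
  have scale (f : 'rV[R]_2 -> R) (N : 'rV[R]_2 -> 'rV[R]_4) :
      smooth_on U f -> smooth_on U N ->
      differentiable (fun q => f q *: N q) p.
    move=> sf sN; apply/differentiable_mx => k l.
    rewrite (_ : (fun _ => _) = (fun q => f q * N q k l)); last first.
      by apply/funext => q; rewrite mxE.
    apply: differentiableM; first exact: smooth_differentiable sf Up.
    exact: (differentiable_mx _ _).1 (smooth_differentiable sN Up) k l.
  by apply: differentiableD; exact: scale.
have ipX q Y : U q -> <<X, Y>> q = pd j lambda q * <<N1, Y>> q + mu j q * <<N2, Y>> q.
  move=> Uq; apply: etrans (congr1 (fun Z => inner (h (F q)) Z (Y q)) (D1 j Uq)) _.
  by rewrite innerDl !innerZl.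
have XT k : <<X, tangent F k>> p = 0 by rewrite ipX// N1T// N2T// !mulr0 addr0.
have N1X : <<N1, X>> p = pd j lambda p * expR (2 * lambda p).
  apply: etrans (ip_sym hT FV N1 X Up) _.
  by rewrite ipX// N11// N21// mulr0 addr0.
have N2X : <<N2, X>> p = - (mu j p * expR (2 * lambda p)).
  apply: etrans (ip_sym hT FV N2 X Up) _.
  by rewrite ipX// N12// N22// mulr0 add0r mulrN.
have covN2X : <<X, cov h F i N2>> p = mu i p * (pd j lambda p * expR (2 * lambda p))
    + pd i lambda p * - (mu j p * expR (2 * lambda p)).
  apply: etrans (ip_sym hT FV X (cov h F i N2) Up) _.
  by apply: etrans (ip_covN2 i Up XT) _; rewrite N1X N2X.
have := etrans (pd_ip oV sh hT hu sF FV i Up dX (smooth_differentiable sN2 Up))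
  (congr1 (fun t => <<cov h F i X, N2>> p + t) covN2X).
have XN2 q : U q -> <<X, N2>> q = - 1 * (mu j q * expR (2 * lambda q)).
  by move=> Uq; rewrite ipX// N12// N22// mulr0 add0r mulrN mulN1r.
rewrite /pd (eq_on_derive _ oU Up XN2).
have dmu := smooth_differentiable (smooth_connection_form j) Up.
have dl := smooth_differentiable slambda Up.
have dE : differentiable (fun q => expR (2 * lambda q)) p.
  apply: differentiable_expR; apply: differentiableM => //.
rewrite (derive_scal _ _ (differentiableM dmu dE)) (derive_mul _ dmu dE).
rewrite -/(pd i (fun q => expR (2 * lambda q)) p) derive_conformal_factor//.
rewrite -/(pd i (mu j) p) -/(pd i lambda p) -/(pd j lambda p).
move: (<<_, _>> p) (pd i (mu j) p) (pd i lambda p) (pd j lambda p) (expR _).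
by move=> c m li lj e H; lra.
Qed.

(** The commutation of the two normal derivatives on [N1] is the vanishing of
the normal curvature. *)
Lemma connection_form_closed i j p : U p ->
  normal_cov h F i (normal_cov h F j N1) p = normal_cov h F j (normal_cov h F i N1) p ->
  pd i (mu j) p = pd j (mu i) p.
Proof.
move=> Up ijC; have e0 := lt0r_neq0 (expR_gt0 (2 * lambda p)).
have N2Tp k : <<N2, tangent F k>> p = 0 by exact: N2T.
have ipC : <<cov h F i (normal_cov h F j N1), N2>> p =
    <<cov h F j (normal_cov h F i N1), N2>> p.
  apply: etrans (esym (ip_normal_part hT FV _ N2Tp Up)) _.
  apply: etrans (ip_normal_part hT FV _ N2Tp Up).
  exact: (congr1 (fun Z => inner (h (F p)) Z (N2 p)) ijC).
have := etrans (esym (ip_cov_normal_cov i j Up))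
  (etrans ipC (ip_cov_normal_cov j i Up)).
move=> /(mulfI e0).
by rewrite [RHS]addrAC => /addIr/addIr/oppr_inj.
Qed.

Lemma lightlike_combination_ip q e c (xi : 'rV[R]_2 -> 'rV[R]_4) Y :
  xi q = c *: (N1 q - e *: N2 q) ->
  <<xi, Y>> q = c * (<<N1, Y>> q - e * <<N2, Y>> q).
Proof. by rewrite /ip => ->; rewrite innerZl innerBl innerZl. Qed.

Section ParallelFields.
Variables (al be : 'I_2 -> 'I_2 -> 'rV[R]_2 -> R) (W : set 'rV[R]_2)
  (gamma : 'rV[R]_2 -> R).
Hypotheses (sff : forall i j p Y, U p -> (forall k, <<Y, tangent F k>> p = 0) ->
    <<cov h F i (tangent F j), Y>> p = al i j p * <<N1, Y>> p + be i j p * <<N2, Y>> p)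
  (oW : open W) (WU : W `<=` U) (sgamma : smooth_on W gamma)
  (dgamma : forall i q, W q -> pd i gamma q = mu i q).

(** With [Y] running over the frame, [h(nabla_i xi, Y)] is the derivative of
[h(xi, Y)] minus [h(xi, nabla_i Y)].  For [Y] tangent the first term is 0 and the
second is the light-like dependence; for [Y] normal the amplitude of the field is
chosen so that the two terms agree. *)
Lemma explicit_field_parallel (e a : R) : is_sign e -> a != 0 ->
  (forall i j q, W q -> al i j q + e * be i j q = 0) ->
  lightlike_parallel_normal_field h F W (explicit_field lambda gamma N1 N2 a e).
Proof.
move=> es a0 dep; set xi := explicit_field _ _ _ _ _ _.
have e2 : e * e = 1 by case: es => ->; rewrite ?mulrNN mulr1.
pose c q := a * expR (- lambda q + e * gamma q).
have xiE q : xi q = c q *: (N1 q - e *: N2 q) by [].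
have ipxi q Y := lightlike_combination_ip Y (xiE q).
have sl : smooth_on W lambda by exact: smooth_sub slambda.
have sc : smooth_on W c.
  apply: (eq_on_smooth (f := fun q => a * expR (- 1 * lambda q + e * gamma q)) oW).
    by move=> q _; rewrite mulN1r.
  apply: (smoothM oW); first exact: (smooth_cst _ oW).
  apply: (smooth_expR oW); apply: (smoothD oW); apply: (smoothM oW) => //;
    exact: (smooth_cst _ oW).
have sxi : smooth_on W xi.
  apply/(smooth_mx _ oW) => k l.
  apply: (eq_on_smooth (f := fun q => c q * (N1 q k l + - e * N2 q k l)) oW).
    by move=> q _; rewrite xiE !mxE mulNr.
  have sN1W := (smooth_mx N1 oW).1 (smooth_sub WU sN1) k l.
  have sN2W := (smooth_mx N2 oW).1 (smooth_sub WU sN2) k l.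
  apply: (smoothM oW) => //; apply: (smoothD oW) => //.
  by apply: (smoothM oW) => //; exact: (smooth_cst _ oW).
have xiT q i : W q -> <<xi, tangent F i>> q = 0.
  by move=> /WU Uq; rewrite ipxi N1T// N2T// mulr0 subrr mulr0.
have xiN1 q : W q -> <<xi, N1>> q = c q * expR (2 * lambda q).
  by move=> /WU Uq; rewrite ipxi N11// N21// mulr0 subr0.
have xiN2 q : W q -> <<xi, N2>> q = e * (c q * expR (2 * lambda q)).
  by move=> /WU Uq; rewrite ipxi N12// N22// mulrN opprK add0r mulrCA.
split; first by split.
move=> q Wq; have Uq := WU Wq.
have cq0 : c q * expR (2 * lambda q) != 0.
  by rewrite !mulf_neq0// gt_eqF// expR_gt0.
split.
- apply: contraNneq cq0 => xi0; rewrite -xiN1// /ip xi0; exact/eqP/inner0l.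
- rewrite ipxi (ip_sym hT FV N1 xi Uq) (ip_sym hT FV N2 xi Uq) xiN1// xiN2//.
  by rewrite mulrA e2 mul1r subrr mulr0.
move=> i.
have dxi := smooth_differentiable sxi Wq.
have dlq := smooth_differentiable slambda Uq.
have dgq := smooth_differentiable sgamma Wq.
have dcq := smooth_differentiable sc Wq.
have dE : differentiable (fun q => expR (2 * lambda q)) q.
  by apply: differentiable_expR; apply: differentiableM.
have pdc : pd i c q = c q * (- pd i lambda q + e * mu i q).
  have d1 : differentiable (fun q => - 1 * lambda q) q by apply: differentiableM.
  have d2 : differentiable (fun q => e * gamma q) q by apply: differentiableM.
  have cE : c = (fun q => a * expR (- 1 * lambda q + e * gamma q)).
    by apply/funext => z; rewrite mulN1r.
  have de : differentiable (fun q => expR (- 1 * lambda q + e * gamma q)) q.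
    by apply: differentiable_expR; exact: differentiableD.
  have d12 : differentiable (fun q => - 1 * lambda q + e * gamma q) q.
    exact: differentiableD.
  rewrite {1}cE /pd (derive_scal _ _ de) (derive_expR_comp _ d12) (derive_add _ d1 d2).
  rewrite (derive_scal _ _ dlq) (derive_scal _ _ dgq).
  by rewrite -!/(pd i _ q) dgamma// /c !mulN1r; ring.
have pdcE : pd i (fun q => c q * expR (2 * lambda q)) q =
    c q * expR (2 * lambda q) * (pd i lambda q + e * mu i q).
  rewrite /pd (derive_mul _ dcq dE) -/(pd i c q) pdc.
  rewrite -/(pd i (fun q => expR (2 * lambda q)) q) derive_conformal_factor//.
  by rewrite -/(pd i lambda q); ring.
have dcE : differentiable (fun q => c q * expR (2 * lambda q)) q.
  exact: differentiableM.
have xiTq k : <<xi, tangent F k>> q = 0 by exact: xiT.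
have covxi Y : smooth_on U Y -> <<cov h F i xi, Y>> q =
    pd i <<xi, Y>> q - <<cov h F i Y, xi>> q.
  move=> sY.
  have -> := pd_ip oV sh hT hu sF FV i Uq dxi (smooth_differentiable sY Uq).
  have -> : <<xi, cov h F i Y>> q = <<cov h F i Y, xi>> q by exact: (ip_sym hT FV).
  by rewrite addrK.
apply: (frame_nondeg (p := q) (X := cov h F i xi) Uq).
- move=> j; apply: etrans (covxi _ (smooth_tangent sF j)) _.
  rewrite (sff i j Uq xiTq) (ip_sym hT FV N1 xi Uq) (ip_sym hT FV N2 xi Uq).
  rewrite xiN1// xiN2// /pd (eq_on_derive (g := cst 0) _ oW Wq); last first.
    by move=> z; exact: xiT.
  rewrite derive_cst sub0r [be i j q * _]mulrCA [e * (be i j q * _)]mulrA -mulrDl dep//.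
  by rewrite mul0r oppr0.
- apply: etrans (covxi _ sN1) _.
  rewrite (ip_covN1 i Uq xiTq) (ip_sym hT FV N1 xi Uq) (ip_sym hT FV N2 xi Uq).
  rewrite xiN1// xiN2// /pd (eq_on_derive _ oW Wq xiN1) -/(pd i _ q) pdcE.
  rewrite -/(pd i lambda q); ring.
- apply: etrans (covxi _ sN2) _.
  rewrite (ip_covN2 i Uq xiTq) (ip_sym hT FV N1 xi Uq) (ip_sym hT FV N2 xi Uq).
  rewrite xiN1// xiN2// /pd (eq_on_derive _ oW Wq xiN2) (derive_scal _ _ dcE).
  rewrite -!/(pd i _ q) pdcE.
  have -> : e * (c q * expR (2 * lambda q) * (pd i lambda q + e * mu i q)) =
    e * (c q * expR (2 * lambda q)) * pd i lambda q
    + e * e * (c q * expR (2 * lambda q)) * mu i q by ring.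
  by rewrite e2; ring.
Qed.

(** Both null components of [xi] are constant multiples of exponentials, and
light-likeness at a single point kills one of the two constants.  The sign [e] is
therefore the same on all of [W]. *)
Lemma parallel_field_explicit p xi : connected W -> W p ->
  lightlike_parallel_normal_field h F W xi ->
  exists e a : R, [/\ is_sign e, a != 0,
    forall i j q, W q -> al i j q + e * be i j q = 0 &
    forall q, W q -> xi q = explicit_field lambda gamma N1 N2 a e q].
Proof.
move=> cW Wp [[sxi xiT] xiP].
pose P := <<xi, N1>>; pose Q := <<xi, N2>>.
have pdxi i Y q : W q -> smooth_on U Y -> pd i <<xi, Y>> q = <<cov h F i Y, xi>> q.
  move=> Wq sY; have Uq := WU Wq; have [_ _ /(_ i) cov0] := xiP q Wq.
  have dxi := smooth_differentiable sxi Wq.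
  apply: etrans (pd_ip oV sh hT hu sF FV i Uq dxi (smooth_differentiable sY Uq)) _.
  have covxi0 : <<cov h F i xi, Y>> q = 0 by rewrite /ip cov0 inner0l.
  apply: etrans (congr1 (fun t => t + <<xi, cov h F i Y>> q) covxi0) _.
  by rewrite add0r; exact: (ip_sym hT FV).
have sWN1 := smooth_sub WU sN1; have sWN2 := smooth_sub WU sN2.
have FVW q : W q -> V (F q) by move=> /WU; exact: FV.
have sP : smooth_on W P.
  exact: (smooth_ip oV sh oW (smooth_sub WU sF) FVW sxi sWN1).
have sQ : smooth_on W Q.
  exact: (smooth_ip oV sh oW (smooth_sub WU sF) FVW sxi sWN2).
have N1xi q : W q -> <<N1, xi>> q = P q by move=> /WU Uq; exact: (ip_sym hT FV).
have N2xi q : W q -> <<N2, xi>> q = Q q by move=> /WU Uq; exact: (ip_sym hT FV).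
have xiTq q (Wq : W q) : forall j, <<xi, tangent F j>> q = 0 by move=> j; exact: xiT.
have pdP i q : W q -> pd i P q = pd i lambda q * P q + mu i q * Q q.
  move=> Wq; apply: etrans (pdxi i _ _ Wq sN1) _.
  by rewrite (ip_covN1 i (WU Wq) (xiTq q Wq)) N1xi// N2xi.
have pdQ i q : W q -> pd i Q q = mu i q * P q + pd i lambda q * Q q.
  move=> Wq; apply: etrans (pdxi i _ _ Wq sN2) _.
  by rewrite (ip_covN2 i (WU Wq) (xiTq q Wq)) N1xi// N2xi.
(* The null components P + s Q solve the scalar equations with rates
   lambda_i + s mu_i. *)
have null_component s : s * s = 1 -> exists c, forall q, W q ->
    P q + s * Q q = c * expR (lambda q + s * gamma q).
  move=> s2; have dsQ q : W q -> differentiable (fun q => s * Q q) q.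
    by move=> Wq; apply: differentiableM => //; exact: smooth_differentiable sQ Wq.
  have dsg q : W q -> differentiable (fun q => s * gamma q) q.
    by move=> Wq; apply: differentiableM => //; exact: smooth_differentiable sgamma Wq.
  have dP q : W q -> differentiable P q by exact: smooth_differentiable.
  have dl q : W q -> differentiable lambda q.
    by move=> /WU; exact: smooth_differentiable.
  apply: (exponential_solution (f := fun q => P q + s * Q q)
    (w := fun q => lambda q + s * gamma q) oW cW _ _ _ Wp).
  - by move=> q Wq; apply: differentiableD; [exact: dP|exact: dsQ].
  - by move=> q Wq; apply: differentiableD; [exact: dl|exact: dsg].
  move=> i q Wq; have dQ := smooth_differentiable sQ Wq.
  have dg := smooth_differentiable sgamma Wq.
  rewrite (derive_add _ (dP q Wq) (dsQ q Wq)) (derive_add _ (dl q Wq) (dsg q Wq)).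
  rewrite (derive_scal _ _ dQ) (derive_scal _ _ dg).
  rewrite -/(pd i P q) -/(pd i Q q) -/(pd i lambda q) -/(pd i gamma q).
  rewrite pdP// pdQ// dgamma//.
  have -> : (pd i lambda q + s * mu i q) * (P q + s * Q q) =
    pd i lambda q * P q + s * (pd i lambda q * Q q) + s * (mu i q * P q)
    + (s * s) * (mu i q * Q q) by ring.
  by rewrite s2; ring.
have expand q : W q -> forall c e, P q = c * expR (2 * lambda q) -> Q q = e * P q ->
    xi q = c *: (N1 q - e *: N2 q).
  move=> Wq c e Pc Qe; have Uq := WU Wq; apply/eqP; rewrite -subr_eq0; apply/eqP.
  pose D z := xi z - c *: (N1 z - e *: N2 z).
  have ipD Y : <<D, Y>> q = <<xi, Y>> q - c * (<<N1, Y>> q - e * <<N2, Y>> q).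
    by rewrite /ip innerBl innerZl innerBl innerZl.
  apply: (frame_nondeg (X := D) Uq).
  - by move=> j; rewrite ipD xiTq// N1T// N2T// mulr0 subrr mulr0 subr0.
  - by rewrite ipD N11// N21// mulr0 subr0 -Pc subrr.
  - rewrite ipD N12// N22// mulrN sub0r opprK -/(Q q) Qe Pc mulrCA.
    by rewrite subrr.
have E1 q : expR (2 * lambda q) = expR (lambda q) * expR (lambda q).
  by rewrite -expRD -mulr2n mulr_natl.
(* Pairing the frame expansion of xi at p with xi itself expresses h(xi, xi)
   by P and Q. *)
have PQ : P p * P p = Q p * Q p.
  have Up := WU Wp; have [_ xi2 _] := xiP p Wp.
  pose E := expR (2 * lambda p); have E0 : E != 0 by rewrite gt_eqF// expR_gt0.
  pose D z := xi z - (E^-1 * P p) *: N1 z + (E^-1 * Q p) *: N2 z.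
  have ipD Y : <<D, Y>> p = <<xi, Y>> p - E^-1 * P p * <<N1, Y>> p
      + E^-1 * Q p * <<N2, Y>> p.
    by rewrite /ip innerDl innerBl !innerZl.
  have D0 : D p = 0.
    apply: (frame_nondeg (X := D) Up).
    - by move=> j; rewrite ipD xiTq// N1T// N2T// !mulr0 subr0 addr0.
    - rewrite ipD N11// N21// mulr0 addr0 -/E -/(P p) mulrAC mulVf// mul1r.
      by rewrite subrr.
    - rewrite ipD N12// N22// mulr0 subr0 -/E -/(Q p) mulrN mulrAC mulVf//.
      by rewrite mul1r subrr.
  have : <<D, xi>> p = 0 by rewrite /ip D0 inner0l.
  rewrite ipD N1xi// N2xi// xi2 sub0r -!mulrA -mulrN -mulrDr => /eqP.
  by rewrite mulf_eq0 invr_eq0 (negbTE E0) /= addrC subr_eq0 => /eqP ->.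
have [cp cpE] := null_component 1 (mulr1 1).
have [cm cmE] := null_component (- 1) (etrans (mulrNN 1 1) (mulr1 1)).
suff [e [a [es PQe]]] : exists e a, is_sign e /\ forall q, W q ->
    P q = a * expR (- lambda q + e * gamma q) * expR (2 * lambda q) /\ Q q = e * P q.
  have xiE q : W q -> xi q = explicit_field lambda gamma N1 N2 a e q.
    by move=> Wq; have [Pq Qq] := PQe q Wq; exact: expand.
  have a0 : a != 0.
    have [xi0 _ _] := xiP p Wp; apply: contraNneq xi0 => a0.
    by rewrite xiE// /explicit_field a0 mul0r scale0r.
  exists e, a; split => // i j q Wq; have Uq := WU Wq; have [Pq Qq] := PQe q Wq.
  have P0 : P q != 0 by rewrite Pq !mulf_neq0// gt_eqF// expR_gt0.
  have : pd i <<xi, tangent F j>> q = 0.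
    rewrite /pd (eq_on_derive (g := cst 0) _ oW Wq) ?derive_cst// => z Wz.
    exact: xiT.
  rewrite (pdxi i (tangent F j) q Wq (smooth_tangent sF j)).
  rewrite (sff i j Uq (xiTq q Wq)) N1xi// N2xi// Qq mulrA -mulrDl => /eqP.
  by rewrite mulf_eq0 (negbTE P0) orbF mulrC => /eqP.
have expE q s : expR (lambda q + s * gamma q) =
    expR (- lambda q + s * gamma q) * expR (2 * lambda q).
  by rewrite -expRD; congr (expR _); ring.
have : cp * cm = 0.
  have e0 s : expR (lambda p + s * gamma p) != 0 by rewrite gt_eqF// expR_gt0.
  have : (P p + 1 * Q p) * (P p + - 1 * Q p) = 0.
    have -> : (P p + 1 * Q p) * (P p + - 1 * Q p) = P p * P p - Q p * Q p by ring.
    by rewrite PQ subrr.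
  rewrite cpE// cmE// => /eqP; rewrite !mulf_eq0 !(negbTE (e0 _)) !orbF.
  by move=> /orP[]/eqP->; rewrite ?mul0r ?mulr0.
move=> /eqP; rewrite mulf_eq0 => /orP[]/eqP c0.
- exists (- 1), (cm / 2); split; first by right.
  move=> q Wq; have := cmE q Wq; have := cpE q Wq; rewrite c0 mul0r expE.
  rewrite -[cm / 2 * _ * _]mulrA.
  move: (expR (- lambda q + - 1 * gamma q) * expR (2 * lambda q)) => z H1 H2.
  by split; lra.
- exists 1, (cp / 2); split; first by left.
  move=> q Wq; have := cmE q Wq; have := cpE q Wq; rewrite c0 mul0r expE.
  rewrite -[cp / 2 * _ * _]mulrA.
  move: (expR (- lambda q + 1 * gamma q) * expR (2 * lambda q)) => z H1 H2.
  by split; lra.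
Qed.

End ParallelFields.
End NormalFrame.

(** * The light-like parallel normal fields *)

(** Congruence to a diagonal matrix of signs forces a nonzero determinant. *)
Lemma has_signature_unitmx {R : realType} n p q (G : 'M[R]_n) :
  has_signature p q G -> G \in unitmx.
Proof.
move=> [_ [P Pu PGP]]; have : P *m G *m P^T \in unitmx.
  rewrite PGP unitmxE det_diag unitfE; apply/prodf_neq0 => i _.
  by rewrite mxE; case: ifP; rewrite ?oppr_eq0 oner_eq0.
by rewrite !unitmx_mul => /andP[/andP[]].
Qed.

Lemma conformal_tangent_orthogonal {R : realType} (h : 'rV[R]_4 -> 'M[R]_4)
    (F : 'rV[R]_2 -> 'rV[R]_4) (lambda : 'rV[R]_2 -> R) p :
  induced_metric h F p =
    expR (2 * lambda p) *: diag_mx (\row_i (if i == 0 then 1 else - 1)) ->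
  forall i j, (ip h F (tangent F i) (tangent F j) p == 0) = (i != j).
Proof.
move=> gE i j; have : induced_metric h F p i j = ip h F (tangent F i) (tangent F j) p.
  by rewrite mxE.
move=> <-; rewrite gE !mxE; have e0 : expR (2 * lambda p) != 0.
  by rewrite gt_eqF// expR_gt0.
have [->|ij] := eqVneq i j; last by rewrite mulr0n mulr0 eqxx.
by rewrite mulr1n mulf_eq0 (negbTE e0) /=; case: ifP; rewrite ?oppr_eq0 oner_eq0.
Qed.

Set Strict Implicit.
Unset Implicit Arguments.

Theorem theorem4p2 (R : realType) (L0 : R)
    (V : set 'rV[R]_4) (h : 'rV[R]_4 -> 'M[R]_4)
    (U : set 'rV[R]_2) (F : 'rV[R]_2 -> 'rV[R]_4) (lambda : 'rV[R]_2 -> R)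
    (N1 N2 : 'rV[R]_2 -> 'rV[R]_4)
    (alpha1 alpha2 alpha3 beta1 beta2 beta3 mu1 mu2 : 'rV[R]_2 -> R) :
  neutral_space_form V h L0 ->
  timelike_conformal_immersion h F U V lambda ->
  normal_frame h F U lambda N1 N2 ->
  sff_components h F U N1 N2 alpha1 alpha2 alpha3 beta1 beta2 beta3 ->
  normal_connection_components h F U lambda N1 N2 mu1 mu2 ->
  flat_normal_connection h F U ->
  (forall p, U p -> gauss_curvature h F p = L0) ->
  forall p, U p ->
  exists W0 : set 'rV[R]_2,
    [/\ open W0, W0 p, W0 `<=` U,
        exists gamma, is_potential W0 gamma mu1 mu2 &
        forall W : set 'rV[R]_2, open W -> connected W -> W p -> W `<=` W0 ->
          ((exists xi, lightlike_parallel_normal_field h F W xi) <->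
           (exists2 e : R, is_sign e &
              lightlike_dependent W e alpha1 alpha2 alpha3 beta1 beta2 beta3))
          /\
          (forall gamma, is_potential W gamma mu1 mu2 ->
             (forall e a : R, is_sign e -> a != 0 ->
                lightlike_dependent W e alpha1 alpha2 alpha3 beta1 beta2 beta3 ->
                lightlike_parallel_normal_field h F W
                  (explicit_field lambda gamma N1 N2 a e)) /\
             (forall xi, lightlike_parallel_normal_field h F W xi ->
                exists e a : R,
                  [/\ is_sign e, a != 0,
                      lightlike_dependent W e
                        alpha1 alpha2 alpha3 beta1 beta2 beta3 &
                      forall q, W q ->
                        xi q = explicit_field lambda gamma N1 N2 a e q]))].
Proof.
move=> [oV [sh hsign] _] [oU sF FV sl gE] [[sN1 N1T] [sN2 N2T] NN] sffE ncE flat _ p Up.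
have hT x : V x -> (h x)^T = h x by move=> /hsign[].
have hu x : V x -> h x \in unitmx by move=> /hsign[_ /has_signature_unitmx].
have TT q i j (Uq : U q) := conformal_tangent_orthogonal (gE q Uq) i j.
(* The indexed form of the data; the off-diagonal entry of the second
   fundamental form is used for both orders of the indices. *)
pose mu (i : 'I_2) := if i == 0 then mu1 else mu2.
pose al (i j : 'I_2) := if i == 0 then (if j == 0 then alpha1 else alpha2)
  else (if j == 0 then alpha2 else alpha3).
pose be (i j : 'I_2) := if i == 0 then (if j == 0 then beta1 else beta2)
  else (if j == 0 then beta2 else beta3).
have N11 q : U q -> ip h F N1 N1 q = expR (2 * lambda q) by move=> /NN[].
have N22 q : U q -> ip h F N2 N2 q = - expR (2 * lambda q) by move=> /NN[].
have N12 q : U q -> ip h F N1 N2 q = 0 by move=> /NN[].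
have D1 (i : 'I_2) q : U q ->
    normal_cov h F i N1 q = pd i lambda q *: N1 q + mu i q *: N2 q.
  move=> /ncE[D01 _ D11 _]; exact: (ord2_ind (P := fun i =>
    normal_cov h F i N1 q = pd i lambda q *: N1 q + mu i q *: N2 q) D01 D11).
have D2 (i : 'I_2) q : U q ->
    normal_cov h F i N2 q = mu i q *: N1 q + pd i lambda q *: N2 q.
  move=> /ncE[_ D02 _ D12]; exact: (ord2_ind (P := fun i =>
    normal_cov h F i N2 q = mu i q *: N1 q + pd i lambda q *: N2 q) D02 D12).
have pair_sff i j q Y (a b : R) : U q -> (forall k, ip h F Y (tangent F k) q = 0) ->
    second_fundamental_form h F i j q = a *: N1 q + b *: N2 q ->
    ip h F (cov h F i (tangent F j)) Y q = a * ip h F N1 Y q + b * ip h F N2 Y q.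
  move=> Uq YT IIij; apply: etrans (esym (ip_normal_part hT FV _ YT Uq)) _.
  apply: etrans (congr1 (fun Z => inner (h (F q)) Z (Y q)) IIij) _.
  by rewrite innerDl !innerZl.
have sff i j q Y : U q -> (forall k, ip h F Y (tangent F k) q = 0) ->
    ip h F (cov h F i (tangent F j)) Y q =
    al i j q * ip h F N1 Y q + be i j q * ip h F N2 Y q.
  move=> Uq YT; have [II00 II01 II11] := sffE q Uq.
  have E00 := pair_sff _ _ _ _ _ _ Uq YT II00.
  have E01 := pair_sff _ _ _ _ _ _ Uq YT II01.
  have E11 := pair_sff _ _ _ _ _ _ Uq YT II11.
  have E10 := etrans (congr1 (fun Z => inner (h (F q)) Z (Y q))
    (cov_tangentC oV sh hT hu oU sF FV 1 0 Uq)) E01.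
  pose P i j := ip h F (cov h F i (tangent F j)) Y q =
    al i j q * ip h F N1 Y q + be i j q * ip h F N2 Y q.
  exact: (ord2_ind (P := fun i => P i j) (ord2_ind (P := P 0) E00 E01 j)
    (ord2_ind (P := P 1) E10 E11 j) i).
have smu i : smooth_on U (mu i).
  exact: (smooth_connection_form oV sh hT hu oU sF FV sl sN1 sN2 N2T N22 N12 D1).
have closed q : U q -> pd 1 mu1 q = pd 0 mu2 q.
  move=> Uq; have /eqP := flat N1 (conj sN1 N1T) q Uq.
  rewrite subr_eq0 => /eqP Rp; apply/esym.
  exact: (connection_form_closed oV sh hT hu oU sF FV sl sN1 sN2 N1T N2T N11 N22 N12
    D1 D2 (i := 0) (j := 1) Uq Rp).
have [W0 [oW0 W0p W0U pot]] := closed_form_potential oU (smu 0) (smu 1) closed Up.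
exists W0; split => // W oW cW Wp WW0; have WU := subset_trans WW0 W0U.
have depE e : lightlike_dependent W e alpha1 alpha2 alpha3 beta1 beta2 beta3 <->
    forall i j q, W q -> al i j q + e * be i j q = 0.
  split=> [dep i j q /dep[d1 d2 d3]|dep q Wq].
    pose P i j := al i j q + e * be i j q = 0.
    exact: (ord2_ind (P := fun i => P i j) (ord2_ind (P := P 0) d1 d2 j)
      (ord2_ind (P := P 1) d2 d3 j) i).
  by split; [exact: (dep 0 0)|exact: (dep 0 1)|exact: (dep 1 1)].
have dgam g : is_potential W g mu1 mu2 -> forall i q, W q -> pd i g q = mu i q.
  move=> [_ gmu] i q /gmu[g0 g1].
  exact: (ord2_ind (P := fun i => pd i g q = mu i q) g0 g1).
have parallel g e a : is_potential W g mu1 mu2 -> is_sign e -> a != 0 ->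
    lightlike_dependent W e alpha1 alpha2 alpha3 beta1 beta2 beta3 ->
    lightlike_parallel_normal_field h F W (explicit_field lambda g N1 N2 a e).
  move=> gP es a0 /depE dep.
  exact: (explicit_field_parallel oV sh hT hu sF FV sl TT sN1 sN2 N1T N2T
    N11 N22 N12 D1 D2 sff oW WU gP.1 (dgam g gP) es a0 dep).
have classify g xi : is_potential W g mu1 mu2 ->
    lightlike_parallel_normal_field h F W xi ->
    exists e a : R, [/\ is_sign e, a != 0,
      lightlike_dependent W e alpha1 alpha2 alpha3 beta1 beta2 beta3 &
      forall q, W q -> xi q = explicit_field lambda g N1 N2 a e q].
  move=> gP xiP.
  have [e [a [es a0 /depE dep xiE]]] := parallel_field_explicit oV sh hT hu sF FV sl TT
    sN1 sN2 N1T N2T N11 N22 N12 D1 D2 sff oW WU gP.1 (dgam g gP) cW Wp xiP.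
  by exists e, a.
have [g0 [sg0 g0mu]] := pot.
have g0P : is_potential W g0 mu1 mu2.
  by split; [exact: smooth_sub sg0|move=> q /WW0 /g0mu].
split; last by move=> g gP; split=> [e a|xi]; [exact: parallel|exact: classify].
split=> [[xi /(classify _ _ g0P)[e [a [es _ dep _]]]]|[e es dep]]; first by exists e.
by exists (explicit_field lambda g0 N1 N2 1 e); apply: parallel; rewrite ?oner_eq0.
Qed.
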